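(* Suppose we have a simple super spectral curve, with Ramond divisor $\mathcal{R}$ consisting of punctures $p_a$, $a\in[r]$, and with $\Delta\lambda$ rescaled by a formal parameter $\gamma$, and a sequence $\{\psi_{g,n}\}_{2g-2+n\ge0}$ of holomorphic multidifferentials. If there exists a sequence $\{\omega_{g,n}\}_{2g-2+n\ge0}$ of symmetric multidifferentials in $(\mathcal{Q}')^{\boxtimes n}[\gamma]$ which satisfies the super loop equations and has the $\psi_{g,n}$ as holomorphic parts, then it can be uniquely and recursively constructed by the following formulae: $$\omega_{g,n+1}(\mathbb{z}_0,\mathbb{z}_{[n]})=\mathcal{H}_0\omega_{g,n+1}(\mathbb{z}_0,\mathbb{z}_{[n]})+\mathcal{P}_0\omega_{g,n+1}(\mathbb{z}_0,\mathbb{z}_{[n]}),$$ where $$\mathcal{H}_0\omega_{g,n+1}(\mathbb{z}_0,\mathbb{z}_{[n]})=\psi_{g,n+1}(\mathbb{z}_0,\mathbb{z}_{[n]})+\sum_{\substack{A'\sqcup B=[n]\\ B\ne\emptyset}}\mathcal{H}_{\{0\}\sqcup A'}\mathcal{P}_B\,\omega_{g,n+1}(\mathbb{z}_0,\mathbb{z}_{[n]}),$$ $$\mathcal{P}_0\omega_{g,n+1}(\mathbb{z}_0,\mathbb{z}_{[n]})=\sum_{p_a\in\mathcal{R}}\operatorname*{Res}_{z=p_a}\frac{\int_{p_a}^{\mathbb{z}}\mathbb{B}^{\mathrm{reg}}(\mathbb{z}_0,\cdot)}{[d\phi]^2\Delta_a\tilde y(z)}\,\mathrm{Rec}^a_{g,n+1}(\mathbb{z};\mathbb{z}_{[n]}),$$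 $$\mathrm{Rec}^a_{g,n+1}(\mathbb{z};\mathbb{z}_{[n]})=(2-\phi D_\phi)\,\mathcal{E}^{2,a}_{g,n}(\mathbb{x};\mathbb{z}_{[n]})+\tfrac12[d\phi]^2\Delta_a\tilde y(\mathbb{z})\,\Delta_a\omega_{g,n+1}(\mathbb{z},\mathbb{z}_{[n]}),$$ and, for any multidifferential, $\Delta_a\omega(\mathbb{z};\mathbb{z}_{[n]})=\omega(\mathbb{z};\mathbb{z}_{[n]})-\omega(\sigma_a(\mathbb{z});\mathbb{z}_{[n]})$ for each $a\in[r]$. The formula is recursive in $2g-2+n+1\ge0$ and also in the degree of $\gamma$, with the initial condition $[\gamma^0]\omega_{0,2}=\mathbb{B}$.
   Context: Base ring: $R=\mathbb{C}[u_1,\dots,u_k,\upsilon_1,\dots,\upsilon_l]$, a freely generated supercommutative algebra ($u_i$ even, $\upsilon_i$ odd). $[n]=\{1,\dots,n\}$, and $\mathbb{z}_I=\{\mathbb{z}_i\}_{i\in I}$. Geometry. $\Sigma$ is a disjoint union of $r$ formal super disks with Ramond coordinates $\mathbb{z}_a=(z_a|\theta_a)$ centred at Ramond punctures $p_a$ (a compact super spectral curve is realised as such a local one through its expansions at the punctures). $\mathbb{x}=(x|\phi):\Sigma\to\mathbb{P}^{1|1}$ is a superconformal map with only simple ramification, at the $p_a$; local coordinates can be chosen so that it is $(z_a^2|\sqrt2z_a\theta_a)$, and $\sigma_a:\mathbb{z}_a\mapsto-\mathbb{z}_a$ is the local involution. $D^*_\theta=\partial_\theta+\theta z\partial_z$,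 $D_\phi=\partial_\phi+\phi\partial_x$. $\mathcal{Q}$ is the quotient of one-forms by those annihilating the superconformal distribution (generated by $D^*_\theta$), $[\cdot]$ denotes the class in $\mathcal{Q}$; $[d\theta]\theta=[dz]/z$, $[d\phi]\phi=[dx]$, $[d\theta]\theta=-\theta[d\theta]$. $\mathcal{Q}'\subset\mathcal{Q}$ consists of residueless sections (residue = coefficient of $[dz]z^{-1}$). An $n$-differential is a meromorphic section of $\mathcal{Q}'^{\boxtimes n}$; symmetric is meant in the graded sense, with $[d\theta_1][d\theta_2]$ exchanged to $-[d\theta_2][d\theta_1]$. $\int^{\mathbb{z}}_{p_a}$ is the primitive. $D_\phi$ acts on sections of $\mathcal{Q}^{\otimes3}$ by declaring $D_\phi([d\phi]^3)=0$. Twisted super quadratic Casimir. For a symmetric bidifferential $\omega=[d\theta_1][d\theta_2]g(\mathbb{z}_1,\mathbb{z}_2)$: $\mathcal{C}^{\sigma}(\omega)(\mathbb{z})=\frac12[d\theta]^3\big(D^*_{\theta_1}g|_{\mathbb{z}_1=\sigma(\mathbb{z}_2)=\mathbb{z}}-D^*_{\theta_1}g|_{\sigma(\mathbb{z}_1)=\mathbb{z}_2=\mathbb{z}}\big)$. Super spectral curve. $\omega_{0,1}=[dx]y+[d\phi]\lambda$ is a meromorphic section of $\mathcal{Q}'$, equal near $p_a$ to $\sum_k[dz_a]t_{a,k}z_a^{k-1}+[d\theta_a]\tau_{a,k}z_a^k$ ($t$ even, $\tau$ odd in $R$, $t_{a,0}=0$, all zero for $k\ll0$). One requires $s_a=\min\{k\text{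 odd}\mid t_{a,k}\text{ invertible}\}\in\{1,3\}$, $\omega_{0,1}(\mathbb{z}_a)+\omega_{0,1}(\sigma_a(\mathbb{z}_a))=[d\theta_a]\mathcal{O}(z_a)$ and $\mathcal{C}^{\sigma_a}(\omega_{0,1}\boxtimes\omega_{0,1})=[d\theta_a]^3\mathcal{O}(z_a^{s_a})$. $\mathbb{B}$ is a symmetric bidifferential which, for $\mathbb{z}_1$ near $p_a$ and $\mathbb{z}_2$ near $p_b$, equals $$\delta_{ab}[d\theta_{a1}][d\theta_{b2}]\Big(-\frac{\theta_{a1}\theta_{b2}z_{a1}z_{b2}}{(z_{a1}-z_{b2})^2}-\frac{z_{a1}+z_{b2}}{2(z_{a1}-z_{b2})}\Big)+\sum_{k,l>0}[dz_{a1}][dz_{b2}]B^{ab}_{kl}z_{a1}^{k-1}z_{b2}^{l-1}+\sum_{k>0,l\ge0}[dz_{a1}][d\theta_{b2}](1-\tfrac{\delta_{0l}}2)\phi^{ab}_{kl}z_{a1}^{k-1}z_{b2}^l$$ $$+\sum_{k\ge0,l>0}[d\theta_{a1}][dz_{b2}](1-\tfrac{\delta_{k0}}2)\phi^{ba}_{lk}z_{a1}^kz_{b2}^{l-1}+\sum_{k,l\ge0}[d\theta_{a1}][d\theta_{b2}](1-\tfrac{\delta_{k0}}2-\tfrac{\delta_{l0}}2)V^{ab}_{kl}z_{a1}^kz_{b2}^l,$$ with $B,V$ even and $\phi$ odd constants in $R$, $B^{ab}_{0l}=B^{ab}_{k0}=\phi^{ab}_{0l}=V^{ab}_{00}=0$,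 $B^{ab}_{kl}=B^{ba}_{lk}$, $V^{ab}_{kl}=-V^{ba}_{lk}$. Simple curves and $\gamma$. With $'=d/dx$, set $\Delta_a\tilde y=\Delta_ay+\frac{\Delta_a\lambda'\,\Delta_a\lambda}{2\Delta_ay}$, where $\Delta_a y,\Delta_a\lambda$ are given by $\Delta_a\omega_{0,1}=[dx]\Delta_ay+[d\phi]\Delta_a\lambda$. The curve is simple if at every $p_a$ the expansion of $\Delta_a\tilde y$ in any local Ramond coordinate is of order $\mathcal{O}(z^{s_a-2})$ with invertible leading coefficient. Rescaling: $\lambda$ is multiplied by a formal even parameter $\gamma$ while $x$, $\phi$, $\Delta_a\tilde y$ and $\mathbb{B}$ are kept unchanged (so $\Delta_ay$ is a quadratic polynomial in $\gamma$). $[\gamma^k]$ denotes the coefficient of $\gamma^k$. Super loop equations. Put $\mathcal{E}^{1,a}_{g,n}(\mathbb{x};\mathbb{z}_{[n]})=\omega_{g,n+1}(\mathbb{z},\mathbb{z}_{[n]})+\omega_{g,n+1}(\sigma_a(\mathbb{z}),\mathbb{z}_{[n]})$ and $\mathcal{E}^{2,a}_{g,n}(\mathbb{x};\mathbb{z}_{[n]})=\mathcal{C}^{\sigma_a}(\omega_{g-1,n+2})(\mathbb{z};\mathbb{z}_{[n]})+\mathcal{C}^{\sigma_a}\big(\sum_{g_1+g_2=g,\,I\sqcup J=[n]}\omega_{g_1,|I|+1}\otimes\omega_{g_2,|J|+1}\big)(\mathbb{z};\mathbb{z}_I;\mathbb{z}_J)$, the Casimir being taken in the first two entries, respectively in the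 first entries of the two factors, and terms with $\omega_{0,1}$ being included. The super loop equations are $\mathcal{E}^{i,a}_{g,n}(\mathbb{x};\mathbb{z}_{[n]})=[d\phi]^{2i-1}\mathcal{O}\big(x^{(s_a-3)(i-1)/2}\big)$ for $i=1,2$ and each $a$, where $x$ is the target coordinate centred at the image of $p_a$. Basis and projections. For $k>0$ let $d\xi_{a,k}=[dz_a]z_a^{k-1}$, $d\eta_{a,k}=[d\theta_a]z_a^k$, $$d\xi_{a,-k}=\frac{[dz_a]}{z_a^{k+1}}+\sum_{b\in[r]}\sum_{l\ge0}\Big([dz_b]\tfrac{2B^{ab}_{kl}+\phi^{ba}_{l0}\phi^{ab}_{k0}}{2k}z_b^{l-1}+[d\theta_b]\tfrac{2\phi^{ab}_{kl}+V^{ab}_{0l}\phi^{ab}_{k0}}{2k}z_b^l\Big),$$ $$d\eta_{a,0}=[d\theta_a]+\sum_{b\in[r]}\sum_{l>0}\Big([dz_b]\phi^{ba}_{l0}z_b^{l-1}+[d\theta_b]V^{ab}_{0l}z_b^l\Big),$$ $$d\eta_{a,-k}=\frac{[d\theta_a]}{z_a^{k}}+\sum_{b\in[r]}\sum_{l\ge0}\Big([dz_b]\tfrac{2\phi^{ba}_{lk}+V^{ab}_{k0}\phi^{ba}_{l0}}{2}z_b^{l-1}+[d\theta_b]\tfrac{2V^{ab}_{kl}+V^{ab}_{k0}V^{ab}_{0l}}{2}z_b^l\Big).$$ The regularised fundamental bidifferential is, for a single puncture with zero mode $d\eta_0$, $\mathbb{B}^{\mathrm{reg}}(\mathbb{z}_1,\mathbb{z}_2)=\mathbb{B}(\mathbb{z}_1,\mathbb{z}_2)-\frac12d\eta_0(\mathbb{z}_1)d\eta_0(\mathbb{z}_2)$,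 i.e. $\mathbb{B}$ with the zero-mode term of its expansion in the basis removed (written in the domain $|z_1|<|z_2|$); for several punctures this regularisation is made for the projection at every puncture $p_a$, with $d\eta_0=d\eta_{a,0}$. Its purpose is that $\operatorname{Res}_{z=p_a}\int_{p_a}^{\mathbb{z}}\mathbb{B}^{\mathrm{reg}}(\mathbb{z}_0,\cdot)\,[d\theta_a]\mathcal{O}(1)=0$. $\mathcal{P}$ is the projection of a differential to its principal part, i.e. to the span of $d\xi_{a,-k},d\eta_{a,-k}$ ($a\in[r]$, $k>0$), given by $\mathcal{P}(\omega)(\mathbb{z}_0)=\sum_{a}\operatorname{Res}_{z=p_a}\int_{p_a}^{\mathbb{z}}\mathbb{B}^{\mathrm{reg}}(\mathbb{z}_0,\cdot)\,\omega(\mathbb{z})$; $\mathcal{H}$ is the projection to the holomorphic part in this basis. Subscripts indicate the variables on which $\mathcal{P}$ and $\mathcal{H}$ act. The $\psi_{g,n}$ are the purely holomorphic parts (holomorphic in all variables) of the $\omega_{g,n}$. *)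

(* Defs.v *)
From HB Require Import structures.
From mathcomp Require Import all_boot all_order all_algebra.
From mathcomp Require Import mpoly.
Set Implicit Arguments. Unset Strict Implicit. Unset Printing Implicit Defensive.
Import Order.TTheory GRing.Theory Num.Theory.
Local Open Scope ring_scope.

(* The algebra A<v_0, ..., v_(l-1)> on l odd generators over a commutative ring A:
   x I is the coefficient of the product of the v_i, i \in I, in increasing order. *)
Definition grassmann (A : comNzRingType) (l : nat) := {ffun {set 'I_l} -> A}.

Section Grassmann.
Variables (A : comNzRingType) (l : nat).
Implicit Types (x y z : grassmann A l) (I J L M : {set 'I_l}).

HB.instance Definition _ := GRing.Zmodule.on (grassmann A l).

Definition shuffle J L : nat := (\sum_(i in J) \sum_(j in L) (j < i))%N.

Definition gmul x y : grassmann A l :=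
  [ffun I : {set 'I_l} =>
     \sum_(J : {set 'I_l} | J \subset I)
        (-1) ^+ shuffle J (I :\: J) * x J * y (I :\: J)].

(* The automorphism x |-> (-1)^|x| x. *)
Definition gparity x : grassmann A l :=
  [ffun I : {set 'I_l} => (-1) ^+ #|I| * x I].

Definition gconst (a : A) : grassmann A l :=
  [ffun I : {set 'I_l} => if I == set0 then a else 0].

Lemma shuffle0l L : shuffle set0 L = 0%N.
Proof. by rewrite /shuffle big_set0. Qed.
Lemma shuffle0r L : shuffle L set0 = 0%N.
Proof. by rewrite /shuffle big1 // => i _; rewrite big_set0. Qed.
Lemma big_disjointU (F : 'I_l -> nat) J L : [disjoint J & L] ->
  (\sum_(i in J :|: L) F i = \sum_(i in J) F i + \sum_(i in L) F i)%N.
Proof. by move=> d; rewrite -bigU //; apply: eq_bigl => i; rewrite !inE. Qed.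
Lemma shuffleUl J L M : [disjoint J & L] ->
  shuffle (J :|: L) M = (shuffle J M + shuffle L M)%N.
Proof. exact: big_disjointU. Qed.
Lemma shuffleUr J L M : [disjoint L & M] ->
  shuffle J (L :|: M) = (shuffle J L + shuffle J M)%N.
Proof.
by move=> d; rewrite /shuffle -big_split; apply: eq_bigr => i _; rewrite big_disjointU.
Qed.

Lemma gmulA : associative gmul.
Proof.
move=> x y z; apply/ffunP=> I; rewrite !ffunE.
transitivity (\sum_(L : {set 'I_l} | L \subset I)
   \sum_(M : {set 'I_l} | M \subset I :\: L)
     (-1) ^+ (shuffle L (I :\: L) + shuffle M (I :\: L :\: M)) *
     (x L * y M * z (I :\: L :\: M))).
  apply: eq_bigr => L _; rewrite ffunE mulr_sumr; apply: eq_bigr => M _.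
  by rewrite exprD -!mulrA; congr (_ * _); rewrite mulrCA.
pose F J L := (-1) ^+ (shuffle J (I :\: J) + shuffle L (J :\: L)) *
  (x L * y (J :\: L) * z (I :\: J)).
transitivity (\sum_(J : {set 'I_l} | J \subset I)
  \sum_(L : {set 'I_l} | L \subset J) F J L); last first.
  apply: eq_bigr => J _; rewrite ffunE mulr_sumr mulr_suml.
  by apply: eq_bigr => L _; rewrite /F exprD !mulrA.
rewrite [RHS](exchange_big_dep (fun L : {set 'I_l} => L \subset I)) /=; last first.
  by move=> J L sJ sL; apply: subset_trans sL sJ.
apply: eq_bigr => L sLI.
rewrite [RHS](reindex_onto (fun M => L :|: M) (fun J => J :\: L)) /=; last first.
  move=> J /andP[_ /subsetP sLJ]; apply/setP=> i; rewrite !inE.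
  by case: (boolP (i \in L)) => //= /sLJ.
have DUK M : [disjoint L & M] = ((L :|: M) :\: L == M).
  apply/idP/eqP=> [|<-]; last by rewrite -setI_eq0 setIDA setIC -setIDA setDv setI0.
  move=> d; apply/setP=> i; rewrite !inE; case: (boolP (i \in L)) => //= iL.
  by rewrite (disjointFr d).
apply: eq_big => M.
  by rewrite subUset sLI subsetUl /= -DUK subsetD disjoint_sym andbT.
rewrite subsetD => /andP[sMI dML].
have eM : (L :|: M) :\: L = M by apply/eqP; rewrite -DUK disjoint_sym.
rewrite /F eM setDDl; congr (_ * _); congr (_ ^+ _).
have dM : [disjoint M & I :\: (L :|: M)].
  by rewrite -setI_eq0; apply/eqP/setP=> i; rewrite !inE; case: (i \in M); rewrite ?orbT.
have eI : I :\: L = M :|: (I :\: (L :|: M)).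
  apply/setP=> i; rewrite !inE; case: (boolP (i \in M)) => [iM|_]; last by rewrite orbF.
  by rewrite (disjointFr dML) // (subsetP sMI).
rewrite {1}eI shuffleUr // shuffleUl 1?disjoint_sym //.
by rewrite -addnA addnC -addnA.
Qed.

Lemma gmul1l : left_id (gconst 1) gmul.
Proof.
move=> x; apply/ffunP=> I; rewrite ffunE (bigD1 (set0 : {set 'I_l})) ?sub0set //=.
rewrite ffunE eqxx setD0 shuffle0l expr0 !mul1r big1 ?addr0 // => J /andP[_ n].
by rewrite ffunE (negPf n) mulr0 mul0r.
Qed.
Lemma gmul1r : right_id (gconst 1) gmul.
Proof.
move=> x; apply/ffunP=> I; rewrite ffunE (bigD1 I) //=.
rewrite ffunE setDv eqxx shuffle0r expr0 mul1r mulr1 big1 ?addr0 // => J /andP[s n].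
rewrite ffunE setD_eq0; case: ifP => [sI|]; last by rewrite mulr0.
by move: n; rewrite eqEsubset s sI.
Qed.
Lemma gmulDl : left_distributive gmul +%R.
Proof.
move=> x y z; apply/ffunP=> I; rewrite !ffunE -big_split; apply: eq_bigr => J _.
by rewrite !ffunE mulrDr mulrDl.
Qed.
Lemma gmulDr : right_distributive gmul +%R.
Proof.
move=> x y z; apply/ffunP=> I; rewrite !ffunE -big_split; apply: eq_bigr => J _.
by rewrite !ffunE mulrDr.
Qed.
Lemma gconst1_neq0 : gconst 1 != 0.
Proof.
by apply/eqP=> /ffunP/(_ set0); rewrite !ffunE eqxx; apply/eqP; rewrite oner_eq0.
Qed.

HB.instance Definition _ := GRing.Zmodule_isNzRing.Build (grassmann A l)
  gmulA gmul1l gmul1r gmulDl gmulDr gconst1_neq0.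
End Grassmann.

From mathcomp Require Import boolp classical_sets functions cardinality fsbigop.
From mathcomp Require Import reals complex.

Record superalgebra (K : fieldType) := SuperAlgebra {
  carrier :> nzRingType;
  scalar : K -> carrier;
  parity : carrier -> carrier }.

(* C[u_1..u_k, v_1..v_l] for K = C. *)
Definition base_ring (K : fieldType) (k l : nat) : superalgebra K :=
  SuperAlgebra (fun c => gconst l (mpolyC k c)) (@gparity {mpoly K[k]} l).

(* R[gamma], gamma even and central: gamma is 'X. *)
Definition gamma_ring (K : fieldType) (k l : nat) : superalgebra K :=
  @SuperAlgebra K {poly base_ring K k l}
    (fun c => (scalar (base_ring K k l) c)%:P)
    (map_poly (@parity _ (base_ring K k l))).

Definition gcoef (K : fieldType) (k l d : nat) (x : gamma_ring K k l) :
  base_ring K k l := (x : {poly base_ring K k l})`_d.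

Definition const (K : fieldType) (k l : nat) (x : base_ring K k l) :
  gamma_ring K k l := (x : base_ring K k l)%:P.

Definition gvar (K : fieldType) (k l : nat) : gamma_ring K k l :=
  ('X : {poly base_ring K k l}).

Local Open Scope classical_set_scope.
Local Open Scope ring_scope.

Section LocalCalculus.
Variables (K : numClosedFieldType) (A : superalgebra K).

Definition even_elt (x : A) := parity x = x.
Definition odd_elt (x : A) := parity x = - x.
Definition invertible (x : A) := exists y : A, x * y = 1 /\ y * x = 1.

Definition zsign (k : int) : A := (-1) ^+ `|k|%N.

(* Laurent series in z, through their coefficients.  All infinite sums below
   have finite support on the series they are used for. *)
Definition lser := int -> A.
Definition laurent (f : lser) := exists N : int, forall k, k < N -> f k = 0.
Definition lmul (f g : lser) : lser :=
  fun k => \sum_(i \in [set: int]) f i * g (k - i).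
Definition lone : lser := fun k => (k == 0)%:R.
(* The inverse of f; it is 0 if f has none. *)
Definition linv (f : lser) : lser :=
  xget (fun=> 0) [set g : lser | laurent g /\ lmul f g = lone].

(* d/dx, for x = z^2 *)
Definition ddx (f : lser) : lser :=
  fun k => scalar A (2^-1 * (k + 2)%:~R) * f (k + 2).

(* f(z) - f(-z) *)
Definition ldelta (f : lser) : lser := fun k => f k - zsign k * f k.

Definition tilde (dy dl : lser) : lser :=
  fun k => dy k + lmul (lmul (ddx dl) dl) (linv (fun j => 2%:R * dy j)) k.

(* [dphi]^2 f = 2 z^2 f [dtheta]^2 *)
Definition dphi2 (f : lser) : lser := fun k => 2%:R * f (k - 2).

(* Superfunctions: F e k is the coefficient, written on the right, of
   theta^e z^k, with theta^true = theta. *)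
Definition sfun := bool -> int -> A.
Definition lact (f : lser) (F : sfun) : sfun :=
  fun e k => \sum_(j \in [set: int]) f j * F e (k - j).

(* D* = d/dtheta + theta z d/dz *)
Definition Dstar (F : sfun) : sfun :=
  fun e k => if e then k%:~R * F false k else F true k.

(* phi = sqrt2 z theta and D* = sqrt2 z D_phi *)
Definition Dphi (F : sfun) : sfun :=
  fun e k => scalar A (sqrtC 2%:R)^-1 * Dstar F e (k + 1).
Definition phimul (F : sfun) : sfun :=
  fun e k => if e then scalar A (sqrtC 2%:R) * F false (k - 1) else 0.

(* phi D_phi on [dtheta]^3 E.  One has [dphi]^3 = 2 sqrt2 z^3 [dtheta]^3, the
   constant 2 sqrt2 cancels, and so do the two signs from moving the odd phi and
   D_phi past [dphi]^3. *)
Definition phiDphi3 (E : sfun) : sfun :=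
  fun e k => phimul (Dphi (fun e' j => E e' (j + 3))) e (k - 3).

(* Sign of theta^e z^k under sigma, if b; sigma changes the signs of z and theta. *)
Definition sigma_sign (b e : bool) (k : int) : A :=
  if b then (-1) ^+ e * zsign k else 1.

(* G e1 k1 e2 k2 is the coefficient of theta1^e1 z1^k1 theta2^e2 z2^k2. *)
Definition bisfun := bool -> int -> bool -> int -> A.
Definition Dstar1 (G : bisfun) : bisfun :=
  fun e1 k1 e2 k2 =>
    if e1 then k1%:~R * G false k1 e2 k2 else G true k1 e2 k2.

(* Restriction to zz1 = sigma^b1 zz, zz2 = sigma^b2 zz. *)
Definition restr (b1 b2 : bool) (G : bisfun) : sfun :=
  let term e1 k1 e2 k2 :=
    sigma_sign b1 e1 k1 * sigma_sign b2 e2 k2 * G e1 k1 e2 k2 in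
  fun e k => \sum_(j \in [set: int])
    (if e then term true j false (k - j) + term false j true (k - j)
     else term false j false (k - j)).

(* C^sigma([dtheta1][dtheta2] G), as the coefficients of [dtheta]^3 *)
Definition casimir (G : bisfun) : sfun :=
  fun e k => scalar A 2^-1 *
    (restr false true (Dstar1 G) e k - restr true false (Dstar1 G) e k).

Definition z12_mul (G : bisfun) : bisfun :=
  fun e1 k1 e2 k2 => G e1 (k1 - 1) e2 k2 - G e1 k1 e2 (k2 - 1).
Definition th1z1_mul (G : bisfun) : bisfun :=
  fun e1 k1 e2 k2 => if e1 then G false (k1 - 1) e2 k2 else 0.

(* C^sigma([dtheta1][dtheta2] N / (z1 - z2)^p): the numerator of D*_1 of the
   quotient over (z1 - z2)^(p + 1) is Nd, and z1 - z2 is 2z, resp. - 2z, on the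
   two restrictions. *)
Definition casimir_diag (p : nat) (N : bisfun) : sfun :=
  let Nd e1 k1 e2 k2 := z12_mul (Dstar1 N) e1 k1 e2 k2
                        - p%:R * th1z1_mul N e1 k1 e2 k2 in
  fun e k => scalar A 2^-1 *
    (scalar A (2%:R ^- p.+1) * restr false true Nd e (k + p.+1%:Z)
     - scalar A ((- 2%:R) ^- p.+1) * restr true false Nd e (k + p.+1%:Z)).

(* The part of B with a pole on the diagonal is [dtheta1][dtheta2] N / (z1 - z2)^2
   for N = - theta1 theta2 z1 z2 - (z1^2 - z2^2)/2. *)
Definition Bnum : bisfun := fun e1 k1 e2 k2 =>
  if [&& e1, e2, k1 == 1 & k2 == 1] then -1
  else if [&& ~~ e1, ~~ e2, k1 == 2 & k2 == 0] then - scalar A 2^-1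
  else if [&& ~~ e1, ~~ e2, k1 == 0 & k2 == 2] then scalar A 2^-1
  else 0.

Section Forms.
Variable r : nat.

(* (a, true, k) stands for [dz_a] z_a^(k-1) = [dtheta_a] theta_a z_a^k, which is
   even, and (a, false, k) for [dtheta_a] z_a^k, which is odd. *)
Definition idx : Type := ('I_r * bool * int)%type.
Definition isodd (i : idx) : bool := ~~ i.1.2.
Definition oddn (s : seq idx) : nat := count isodd s.

(* An n-differential is w : mform restricted to the lists s of size n: w [:: i_1;
   ...; i_n] is the coefficient, written on the right, of e_(i_1)(zz_1) ...
   e_(i_n)(zz_n).  A pole on a diagonal z_i = z_j, i < j, is expanded in the
   domain |z_i| < |z_j|. *)
Definition mform := seq idx -> A.

(* Finite pole order at the punctures, and no residue. *)
Definition laurent_form (n : nat) (w : mform) :=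
  (exists N : int, forall s, size s = n ->
     has (fun i : idx => i.2 < N) s -> w s = 0) /\
  (forall s, size s = n -> has (fun i : idx => i.1.2 && (i.2 == 0)) s -> w s = 0).

Definition holomorphic_form (n : nat) (w : mform) :=
  forall s, size s = n ->
    has (fun i : idx => if i.1.2 then i.2 <= 0 else i.2 < 0) s -> w s = 0.

(* Adjacent exchanges generate all permutations. *)
Definition graded_symmetric (n : nat) (w : mform) :=
  forall s1 i j s2, size (s1 ++ [:: i, j & s2]) = n ->
    w (s1 ++ [:: j, i & s2]) =
    (-1) ^+ (isodd i && isodd j) * w (s1 ++ [:: i, j & s2]).

(* Number of exchanges of odd factors which sort e_I e_J, where I is given by the
   mask m on s and J is its complement. *)
Fixpoint unshuffle (m : seq bool) (s : seq idx) : nat :=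
  match m, s with
  | b :: m', i :: s' =>
      (if b then 0 else isodd i * oddn (mask m' s')) + unshuffle m' s'
  | _, _ => 0
  end%N.

(* The coefficient of e_i(zz) e_j(zz') e_s(zz_[n]) in w1(zz, zz_I) w2(zz', zz_J). *)
Definition tensor (w1 w2 : mform) (m : seq bool) (i j : idx) (s : seq idx) : A :=
  let sI := mask m s in let sJ := mask (map negb m) s in
  (-1) ^+ (oddn sI * isodd j + unshuffle m s)%N
  * iter (isodd j + oddn sJ)%N (@parity _ A) (w1 (i :: sI)) * w2 (j :: sJ).

(* e_i(zz_1) e_j(zz_2) c = [dtheta_1][dtheta_2] G near (p_a, p_a); the sign comes
   from theta_1 [dtheta_2] = - [dtheta_2] theta_1. *)
Definition biform_fun (a : 'I_r) (c : idx -> idx -> A) : bisfun :=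
  fun e1 k1 e2 k2 => (-1) ^+ e1 * c (a, e1, k1) (a, e2, k2).

(* omega(sigma_a(zz), zz_[n]); sigma^* [dtheta] = - [dtheta] *)
Definition sigma_form (w : mform) (a : 'I_r) (s : seq idx) : sfun :=
  fun e k => - sigma_sign true e k * w ((a, e, k) :: s).

Definition Delta (w : mform) (a : 'I_r) (s : seq idx) : sfun :=
  fun e k => w ((a, e, k) :: s) - sigma_form w a s e k.

(* The linear operator e_j |-> \sum_i e_i M i j, of even parity, in the variable
   number p: M moves past the later factors. *)
Definition act (M : idx -> idx -> A) (p : nat) (w : mform) : mform :=
  fun s => if drop p s is i :: s' then
    \sum_(j \in [set: idx])
      iter (oddn s') (@parity _ A) (M i j) * w (take p s ++ j :: s')
  else 0.

End Forms.

(* The polar part of B expanded in |z1| < |z2|, resp. in |z2| < |z1|. *)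
Definition Bpolar12 (r : nat) (i j : idx r) : A :=
  let: (a, e1, k1) := i in let: (b, e2, k2) := j in
  if (a == b) && (e1 == e2) && (k1 + k2 == 0) then
    if e1 then (if 0 < k1 then k1%:~R else 0)
    else if 0 < k1 then 1 else if k1 == 0 then scalar A 2^-1 else 0
  else 0.
Definition Bpolar21 (r : nat) (i j : idx r) : A :=
  let: (a, e1, k1) := i in let: (b, e2, k2) := j in
  if (a == b) && (e1 == e2) && (k1 + k2 == 0) then
    if e1 then (if 0 < k2 then k2%:~R else 0)
    else if 0 < k2 then -1 else if k2 == 0 then - scalar A 2^-1 else 0
  else 0.

End LocalCalculus.

Section Curve.
Variables (K : numClosedFieldType) (k l r : nat).
Local Notation R := (base_ring K k l).
Local Notation S := (gamma_ring K k l).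
Local Notation idx := (idx r).

Record curve_data := CurveData {
  ct : 'I_r -> int -> R;
  ctau : 'I_r -> int -> R;
  cs : 'I_r -> nat;
  cB : 'I_r -> 'I_r -> nat -> nat -> R;
  cphi : 'I_r -> 'I_r -> nat -> nat -> R;
  cV : 'I_r -> 'I_r -> nat -> nat -> R }.

Variable C : curve_data.

Definition omega01 : mform R r := fun s =>
  if s is [:: (a, e, j)] then if e then ct C a j else ctau C a j else 0.

(* omega_{0,1} = [dx] y + [dphi] lambda, with [dx] = 2 z [dz] and
   [dphi] = sqrt2 z [dtheta]. *)
Definition cy (a : 'I_r) : lser R := fun j => scalar R 2^-1 * ct C a (j + 2).
Definition clambda (a : 'I_r) : lser R :=
  fun j => scalar R (sqrtC 2%:R)^-1 * ctau C a (j + 1).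
Definition cDytilde (a : 'I_r) : lser R :=
  tilde (ldelta (cy a)) (ldelta (clambda a)).

Definition super_spectral_curve :=
  (forall a,
    [/\ forall j, even_elt (ct C a j) /\ odd_elt (ctau C a j),
        ct C a 0 = 0,
        laurent (ct C a) & laurent (ctau C a)]) /\
  (forall a,
    [/\ cs C a = 1%N \/ cs C a = 3%N,
        invertible (ct C a (cs C a)%:Z) &
        forall j : int, odd `|j|%N -> j < (cs C a)%:Z -> ~ invertible (ct C a j)]) /\
  (forall a e (j : int), j < 1 ->
     omega01 [:: (a, e, j)] + sigma_form omega01 a [::] e j = 0) /\
  (forall a e (j : int), j < (cs C a)%:Z ->
     casimir (biform_fun a (fun i1 i2 => tensor omega01 omega01 [::] i1 i2 [::])) e j
     = 0) /\
  (forall a b i j,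
    [/\ even_elt (cB C a b i j), odd_elt (cphi C a b i j) & even_elt (cV C a b i j)]) /\
  (forall a b j,
    [/\ cB C a b 0%N j = 0, cB C a b j 0%N = 0, cphi C a b 0%N j = 0 & cV C a b 0%N 0%N = 0]) /\
  (forall a b i j, cB C a b i j = cB C b a j i /\ cV C a b i j = - cV C b a j i).

(* Another Ramond coordinate at p_a is z times a unit: the order and the
   invertibility of the leading coefficient do not depend on the coordinate. *)
Definition simple_curve := forall a,
  (forall j : int, j < (cs C a)%:Z - 2 -> cDytilde a j = 0) /\
  invertible (cDytilde a ((cs C a)%:Z - 2)).

(* The part of B which is regular at the punctures. *)
Definition Breg0 (i j : idx) : R :=
  let: (a, e1, k1) := i in let: (b, e2, k2) := j in
  let h (n : int) : K := (n == 0)%:R / 2%:R in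
  match e1, e2 with
  | true, true =>
      if (0 < k1) && (0 < k2) then cB C a b `|k1|%N `|k2|%N else 0
  | true, false =>
      if (0 < k1) && (0 <= k2) then scalar R (1 - h k2) * cphi C a b `|k1|%N `|k2|%N
      else 0
  | false, true =>
      if (0 <= k1) && (0 < k2) then scalar R (1 - h k1) * cphi C b a `|k2|%N `|k1|%N
      else 0
  | false, false =>
      if (0 <= k1) && (0 <= k2) then
        scalar R (1 - h k1 - h k2) * cV C a b `|k1|%N `|k2|%N
      else 0
  end.

Definition B12 (i j : idx) : R := Bpolar12 R i j + Breg0 i j.
Definition B21 (i j : idx) : R := Bpolar21 R i j + Breg0 i j.

(* The coefficients of d eta_{a,0}. *)
Definition eta0 (a : 'I_r) (i : idx) : R :=
  let: (b, e, j) := i in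
  if e then (if 0 < j then cphi C b a `|j|%N 0%N else 0)
  else if 0 < j then cV C a b 0%N `|j|%N else ((b == a) && (j == 0))%:R.

(* B^reg(zz_0, zz), zz near p_a, in the domain |z| < |z_0| where its second
   argument is the small one.  B^reg is B - (d eta_0) (d eta_0)/2 for a small first
   argument; it is graded symmetric and d eta_0 is odd, whence the sign +. *)
Definition Breg (i j : idx) : R :=
  B21 i j + scalar R 2^-1
            * (iter (isodd j) (@parity _ R) (eta0 j.1.1 i) * eta0 j.1.1 j).

(* \sum_a Res_(z = p_a) \int_(p_a)^zz B^reg(zz_0, .) w(zz) = act Pkernel 0 w.
   The primitive of [dz] z^(j-1) is z^j / j and that of [dtheta] z^j is theta z^j
   (these primitives have no constant term: B^reg(zz_0, .) has no term [dz]/z).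
   The residue of z^m [dz] z^(j-1) is 1 if m + j = 0; that of
   theta z^m [dtheta] z^j = - [dz] z^(m+j-1) is then -1; all others vanish. *)
Definition Pkernel (i j : idx) : S :=
  let: (a, e, m) := j in
  const (if e then scalar R ((- m)%:~R)^-1 * Breg i (a, true, - m)
         else - parity (Breg i (a, false, - m))).

Definition Pop (p : nat) (w : mform S r) : mform S r := act Pkernel p w.
(* Pop p w has the same polar part as w in the variable p, so this is holomorphic
   in it. *)
Definition Hop (p : nat) (w : mform S r) : mform S r := fun s => w s - Pop p w s.

(* P in the variables of B and H in the others, among zz_0, ..., zz_(n-1). *)
Definition HPop (n : nat) (B : {set 'I_n}) (w : mform S r) : mform S r :=
  foldr (fun (p : 'I_n) v => if p \in B then Pop p v else Hop p v) w (enum 'I_n).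

(* yg is the function y of the curve with lambda replaced by gamma lambda: the
   difference Delta ytilde and the sum y(z) + y(-z) are unchanged. *)
Definition rescaled (yg : 'I_r -> lser S) := forall a,
  [/\ laurent (yg a),
      forall j, even_elt (yg a j),
      forall j, yg a j + zsign S j * yg a j = const (cy a j + zsign R j * cy a j) &
      tilde (ldelta (yg a)) (fun j => gvar K k l * const (ldelta (clambda a) j))
      = fun j => const (cDytilde a j)].

Variable yg : 'I_r -> lser S.

Definition omega01g : mform S r := fun s =>
  if s is [:: (a, e, j)] then
    if e then 2%:R * yg a (j - 2)
    else scalar S (sqrtC 2%:R) * (gvar K k l * const (clambda a (j - 1)))
  else 0.

Definition multidiff_family := nat -> mform S r.

(* omega_{0,2} - B, and omega_{g,n} otherwise *)
Definition regular_part (w : multidiff_family) : multidiff_family := fun g s =>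
  w g s - (if (g, s) is (0%N, [:: i; j]) then const (B12 i j) else 0).

Definition with_omega01 (w : multidiff_family) : multidiff_family := fun g s =>
  if (g == 0%N) && (size s == 1%N) then omega01g s else w g s.

(* Symmetric multidifferentials omega_{g,n+1}, 2g - 2 + n + 1 >= 0, polynomial in
   gamma; omega_{0,2} has on the diagonal the poles of B, and there are no other
   poles than this one and those at the punctures. *)
Definition symmetric_family (w : multidiff_family) := forall g n, (0 < 2 * g + n)%N ->
  let v := regular_part w g in
  [/\ laurent_form n.+1 v,
      exists D, forall s, size s = n.+1 -> forall d, (D < d)%N -> gcoef d (v s) = 0 &
      graded_symmetric n.+1 v].

Definition initial_condition (w : multidiff_family) :=
  forall i j, gcoef 0 (w 0%N [:: i; j]) = B12 i j.

Definition E1 (w : multidiff_family) (a : 'I_r) (g : nat) (s : seq idx) : sfun S :=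
  fun e j => w g ((a, e, j) :: s) + sigma_form (w g) a s e j.

(* The first summand is C^sigma(omega_{g-1,n+2}); for omega_{0,2} the polar part
   of B is restricted as a function, not through an expansion. *)
Definition E2 (w : multidiff_family) (a : 'I_r) (g : nat) (s : seq idx) : sfun S :=
  fun e j =>
    (if g is g'.+1 then
       if (g' == 0%N) && nilp s then
         casimir (biform_fun a (fun i1 i2 => w 0%N [:: i1; i2] - Bpolar12 S i1 i2)) e j
         + casimir_diag 2 (@Bnum K S) e j
       else casimir (biform_fun a (fun i1 i2 => w g' [:: i1, i2 & s])) e j
     else 0)
    + casimir (biform_fun a (fun i1 i2 =>
        \sum_(g1 < g.+1) \sum_(m : (size s).-tuple bool)
          tensor (with_omega01 w g1) (with_omega01 w (g - g1)%N) m i1 i2 s)) e j.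

(* [dphi]^p O(x^m), m2 = 2 m, as coefficients of [dtheta]^p: the section
   [dphi]^p phi^e x^i is a multiple of [dtheta]^p theta^e z^(p + e + 2 i). *)
Definition target_order (p : nat) (m2 : int) (F : sfun S) :=
  forall (e : bool) (j : int), j < p%:Z + (e : nat)%:Z + m2 -> F e j = 0.

Definition linear_loop_equations (w : multidiff_family) :=
  forall a g s, (0 < 2 * g + size s)%N -> target_order 1 0 (E1 w a g s).
Definition quadratic_loop_equations (w : multidiff_family) :=
  forall a g s, (0 < 2 * g + size s)%N ->
    target_order 3 ((cs C a)%:Z - 3) (E2 w a g s).
Definition super_loop_equations (w : multidiff_family) :=
  linear_loop_equations w /\ quadratic_loop_equations w.

(* [gamma^0] omega_{0,2} = B is the initial condition and is left out. *)
Definition beyond_initial (g n d : nat) := (g, n, d) != (0, 1, 0)%N.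

Definition holomorphic_parts (psi w : multidiff_family) :=
  forall g n d s, (0 < 2 * g + n)%N -> beyond_initial g n d -> size s = n.+1 ->
    gcoef d (HPop (finset.set0 : {set 'I_(n.+1)}) (w g) s) = gcoef d (psi g s).

Definition loop_solution (psi w : multidiff_family) :=
  [/\ symmetric_family w, initial_condition w, super_loop_equations w &
      holomorphic_parts psi w].

Definition Rec (w : multidiff_family) (a : 'I_r) (g : nat) (s : seq idx) : sfun S :=
  fun e j => 2%:R * E2 w a g s e j - phiDphi3 (E2 w a g s) e j
    + scalar S 2^-1
      * lact (dphi2 (fun m => const (cDytilde a m))) (Delta (w g) a s) e j.

(* \sum_a Res_(z = p_a) of \int B^reg(zz_0, .) / ([dphi]^2 Delta_a ytilde) times
   Rec^a_{g,n+1} *)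
Definition P0_rhs (w : multidiff_family) (g : nat) : mform S r :=
  act Pkernel 0 (fun s => if s is (a, e, j) :: s' then
    lact (linv (dphi2 (fun m => const (cDytilde a m)))) (Rec w a g s') e j else 0).

Definition H0_rhs (psi w : multidiff_family) (g n : nat) : mform S r := fun s =>
  psi g s + \sum_(B : {set 'I_(n.+1)} | (B != finset.set0) && (ord0 \notin B))
              HPop B (w g) s.

Definition recursion_formulae (psi w : multidiff_family) :=
  forall g n s, (0 < 2 * g + n)%N -> size s = n.+1 ->
    [/\ w g s = Hop 0 (w g) s + Pop 0 (w g) s,
        forall d, beyond_initial g n d ->
          gcoef d (Hop 0 (w g) s) = gcoef d (H0_rhs psi w g n s) &
        Pop 0 (w g) s = P0_rhs w g s].

(* Equality of all [gamma^d'] omega_{g',n'+1} with (2g'+n', d') lexicographically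
   smaller than (2g+n, d). *)
Definition agree_below (w w' : multidiff_family) (g n d : nat) :=
  forall g' n' d' s, (0 < 2 * g' + n')%N ->
    (2 * g' + n' < 2 * g + n)%N \/ (2 * g' + n' = 2 * g + n)%N /\ (d' < d)%N ->
    size s = n'.+1 -> gcoef d' (w' g' s) = gcoef d' (w g' s).

Definition candidate (w : multidiff_family) :=
  [/\ symmetric_family w, initial_condition w & linear_loop_equations w].

(* The right-hand sides only involve lower orders: the one for P_0, and then, given
   P_0 omega_{g,n+1} (hence, by symmetry, P in every variable), the one for H_0. *)
Definition recursive_at (psi w : multidiff_family) :=
  forall w' g n d, candidate w' -> (0 < 2 * g + n)%N -> agree_below w w' g n d ->
    (forall s, size s = n.+1 -> gcoef d (P0_rhs w' g s) = gcoef d (P0_rhs w g s)) /\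
    ((forall s, size s = n.+1 -> gcoef d (Pop 0 (w' g) s) = gcoef d (Pop 0 (w g) s)) ->
     forall s, size s = n.+1 ->
       gcoef d (H0_rhs psi w' g n s) = gcoef d (H0_rhs psi w g n s)).

End Curve.

(* Main.v *)
(* Let D = [dphi]^2 Delta_a ytilde, of order s_a with invertible leading coefficient.
   Below the order s_a the loop equations leave nothing of Rec^a but D omega_{g,n+1}:
   the Casimir drops out, and Delta_a omega / 2 = omega - E^1 / 2.  The kernel
   int B^reg only sees the polar coefficients of its argument, so that it sends Rec^a / D
   to P_0 omega_{g,n+1}.  The formula for H_0 is the expansion of the product of the
   (H_i + P_i), i in [n], which is the identity.
   For the recursivity, omega_{g,n+1} enters Rec^a only through its products with
   omega_{0,1} and through Delta_a omega_{g,n+1}.  In the top degree in gamma only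
   the part of omega_{0,1} of degree 0 matters, and the products of anti-invariant parts
   cancel against D Delta_a omega / 2.  For the uniqueness, a form whose polar part in
   the first variable is known has by symmetry a known polar part in all variables. *)
Require Import Defs.
From mathcomp Require Import all_boot all_order all_algebra.
From mathcomp Require Import mpoly boolp classical_sets functions cardinality fsbigop.
From mathcomp Require Import reals complex.
From mathcomp Require Import zify.
Set Implicit Arguments. Unset Strict Implicit. Unset Printing Implicit Defensive.
Import Order.TTheory GRing.Theory Num.Theory.
Local Open Scope ring_scope.

(** * Parity and centre of the base ring *)

(** Infinite sums of coefficients have the value 0 unless their support is finite, so every
    rearrangement needs a lower bound on orders. The diagonal pole of omega_{0,2} rules out a bound
    uniform in all variables: this forces iterated Laurent expansions, and symmetry is used only on
    differences of two candidates, in which B cancels. The operator 2 - phi D_phi is there to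
    balance the Casimir. Because of D*, only one of the two products of omega_{0,1} with
    omega_{g,n+1} reaches the theta^0 component, while both reach the theta^1 component and
    contribute equally. The operator multiplies these components by 2 and by 1, so with the factor
    1/2 of the Casimir each counts once. The cancellation against D Delta_a omega / 2 is exact
    because the correction in ytilde carries a factor gamma: at gamma = 0 the rescaled Delta_a y is
    Delta_a ytilde itself. *)

Section GrassmannCenter.
Variables (A : idomainType) (l : nat).
Implicit Types (x y : grassmann A l) (I J L : {set 'I_l}).

Lemma gconstM a y I : (gconst l a * y : grassmann A l) I = a * y I.
Proof.
rewrite [LHS]ffunE (bigD1 (finset.set0 : {set 'I_l})) ?finset.sub0set //=.
rewrite ffunE eqxx finset.setD0 shuffle0l expr0 !mul1r big1 ?addr0 // => J /andP[_ n].
by rewrite ffunE (negPf n) mulr0 mul0r.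
Qed.

Lemma gparity0 : gparity (0 : grassmann A l) = 0.
Proof. by apply/ffunP => I; rewrite !ffunE mulr0. Qed.

Lemma gparityD : {morph @gparity A l : x y / x + y}.
Proof. by move=> x y; apply/ffunP => I; rewrite !ffunE mulrDr. Qed.

Lemma gparityN : {morph @gparity A l : x / - x}.
Proof. by move=> x; apply/ffunP => I; rewrite !ffunE mulrN. Qed.

Lemma gparity_const (a : A) : gparity (gconst l a) = gconst l a.
Proof.
apply/ffunP => I; rewrite !ffunE; case: eqP => [->|_]; last by rewrite mulr0.
by rewrite finset.cards0 expr0 mul1r.
Qed.

(** A pair in J x L has distinct entries, so exactly one of the two shuffle numbers counts it. *)
Lemma shuffleC J L : [disjoint J & L] -> (shuffle J L + shuffle L J = #|J| * #|L|)%N.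
Proof.
move=> dJL; rewrite /shuffle [X in (_ + X)%N]exchange_big -big_split /=.
rewrite -sum_nat_const; apply: eq_bigr => i iJ; rewrite -big_split /=.
rewrite -[RHS]sum1_card; apply: eq_bigr => j jL.
have : (i != j :> nat).
  by apply: contraTneq jL => /val_inj <-; rewrite (disjointFr dJL iJ).
by case: ltngtP.
Qed.

(** As 2 is cancellable, an even x has no coefficient on sets of odd size. For J of even size,
    [shuffleC] makes the signs of the two orders of multiplication agree, and the sums match under
    the complement J -> I \ J. *)
Lemma gparity_even_comm x y : 2%:R != 0 :> A -> gparity x = x -> x * y = y * x.
Proof.
move=> two ex.
have odd0 J : odd #|J| -> x J = 0.
  move=> oJ; have := congr1 (fun z : grassmann A l => z J) ex.
  rewrite ffunE -signr_odd oJ expr1 mulN1r => /eqP; rewrite eq_sym -subr_eq0 opprK.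
  by rewrite -mulr2n -mulr_natl mulf_eq0 (negPf two) => /eqP.
apply/ffunP => I; rewrite [LHS]ffunE [RHS]ffunE.
rewrite [RHS](reindex_onto (fun J => I :\: J) (fun J => I :\: J)) /=; last first.
  by move=> J sJ; rewrite finset.setDDr finset.setDv finset.set0U; apply/finset.setIidPr.
apply: eq_big => [J|J sJ].
  rewrite finset.subsetDl /= finset.setDDr finset.setDv finset.set0U.
  by apply/idP/eqP => /finset.setIidPr.
rewrite finset.setDDr finset.setDv finset.set0U (finset.setIidPr sJ).
have [oJ|eJ] := boolP (odd #|J|); first by rewrite odd0 // !(mulr0, mul0r).
rewrite mulrAC; congr (_ * _ * _).
have dJ : [disjoint J & I :\: J].
  by rewrite -finset.setI_eq0; apply/eqP/finset.setP => i; rewrite !inE; case: (i \in J).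
have := shuffleC dJ; move=> /(congr1 odd); rewrite oddD oddM (negPf eJ) /= => o.
by rewrite -signr_odd -[in RHS]signr_odd; move: o; do 2!case: (odd _).
Qed.
End GrassmannCenter.

(** The induction step for expanding a product of sums H_p + P_p over subsets of slots. *)
Lemma big_subsetU1 (T : finType) (V : nmodType) (D : {set T}) p (G : {set T} -> V) :
  p \notin D ->
  \sum_(B : {set T} | B \subset p |: D) G B =
  \sum_(B : {set T} | B \subset D) (G B + G (p |: B)).
Proof.
move=> pD; rewrite big_split /= (bigID (fun B : {set T} => p \in B)) /= addrC.
congr (_ + _).
  apply: eq_bigl => B; rewrite andbC; apply/andP/idP => [[pB /fintype.subsetP sB]|sB].
    apply/fintype.subsetP => x xB; have := sB x xB; rewrite finset.in_setU1.
    by case: eqP => // xp; rewrite -xp xB in pB.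
  split; first by apply: contra pD; apply: (fintype.subsetP sB).
  by apply: fintype.subset_trans sB _; apply: finset.subsetUr.
rewrite (reindex_onto (fun B => p |: B) (fun B => B :\ p)) /=; last first.
  by move=> B /andP[_]; apply: finset.setD1K.
apply: eq_bigl => B; rewrite finset.setU11 andbT.
apply/andP/idP => [[/fintype.subsetP sB /eqP pB]|sB].
  have pB' : p \notin B by rewrite -pB finset.in_setD1 eqxx.
  apply/fintype.subsetP => x xB; have := sB x; rewrite !finset.in_setU1 xB orbT => /(_ isT).
  by case: eqP => // xp; rewrite -xp xB in pB'.
split; first exact: finset.setUS.
by rewrite finset.setU1K //; apply: contra pD; apply: (fintype.subsetP sB).
Qed.

Local Open Scope classical_set_scope.
Local Open Scope ring_scope.

(** * Sums with finite support *)

Section FiniteSums.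
Variables (T : choiceType).

(** A sum over [[set: T]] with infinite support takes the default value 0, so additivity requires an
    explicit list containing the support. *)
Definition supported (V : nmodType) (l : seq T) (f : T -> V) :=
  forall j, j \notin l -> f j = 0.

Lemma fsum_seq (V : nmodType) (l : seq T) (f : T -> V) :
  supported l f -> \sum_(j \in [set: T]) f j = \sum_(j <- undup l) f j.
Proof.
move=> sf; have -> : [set: T] = [set` predT] by apply/seteqP; split.
by apply/esym; apply: bigfs (undup_uniq l) _ => i _; rewrite mem_undup; apply: sf.
Qed.

Lemma supportedW (V : nmodType) (l l' : seq T) (f : T -> V) :
  {subset l <= l'} -> supported l f -> supported l' f.
Proof. by move=> sl sf j jl; apply: sf; apply: contra jl; apply: sl. Qed.

Lemma eq_fsum (V : nmodType) (f g : T -> V) :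
  f =1 g -> \sum_(j \in [set: T]) f j = \sum_(j \in [set: T]) g j.
Proof. by move=> fg; apply: eq_fsbigr => j _; apply: fg. Qed.

Lemma fsum0 (V : nmodType) (f : T -> V) :
  (forall j, f j = 0) -> \sum_(j \in [set: T]) f j = 0.
Proof. by move=> f0; apply: fsbig1 => j _; apply: f0. Qed.

(** No support condition: the sum is always a finite iterated one, possibly empty. *)
Lemma fsum_ind (V : nmodType) (P : V -> Prop) (f : T -> V) :
  P 0 -> (forall x y, P x -> P y -> P (x + y)) -> (forall j, P (f j)) ->
  P (\sum_(j \in [set: T]) f j).
Proof. by move=> P0 PD Pf; elim/big_ind: _. Qed.

Lemma fsum_additive (V W : nmodType) (h : V -> W) (l : seq T) (f : T -> V) :
  h 0 = 0 -> {morph h : x y / x + y} -> supported l f ->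
  h (\sum_(j \in [set: T]) f j) = \sum_(j \in [set: T]) h (f j).
Proof.
move=> h0 hD sf; rewrite (fsum_seq sf) (@fsum_seq _ l) ?(big_morph h hD h0) //.
by move=> j /sf ->.
Qed.

Lemma fsumD (V : nmodType) (l l' : seq T) (f g : T -> V) :
  supported l f -> supported l' g ->
  \sum_(j \in [set: T]) (f j + g j) =
  \sum_(j \in [set: T]) f j + \sum_(j \in [set: T]) g j.
Proof.
move=> sf sg.
have {}sf : supported (l ++ l') f.
  by apply: supportedW sf => x; rewrite mem_cat => ->.
have {}sg : supported (l ++ l') g.
  by apply: supportedW sg => x; rewrite mem_cat orbC => ->.
rewrite (fsum_seq sf) (fsum_seq sg) (@fsum_seq _ (l ++ l')) ?big_split //.
by move=> j jl; rewrite sf // sg // addr0.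
Qed.

Lemma fsumB (V : zmodType) (l l' : seq T) (f g : T -> V) :
  supported l f -> supported l' g ->
  \sum_(j \in [set: T]) (f j - g j) =
  \sum_(j \in [set: T]) f j - \sum_(j \in [set: T]) g j.
Proof.
move=> sf sg; rewrite (fsum_additive (oppr0 V) (@opprD V) sg).
by apply: (fsumD sf) => j /sg ->; apply: oppr0.
Qed.

Lemma fsum_sum (V : nmodType) (I : finType) (P : pred I) (F : I -> T -> V) :
  (forall i, exists l, supported l (F i)) ->
  \sum_(j \in [set: T]) (\sum_(i | P i) F i j) =
  \sum_(i | P i) \sum_(j \in [set: T]) F i j.
Proof.
move=> sF; pose l i := projT1 (cid (sF i)).
have sFl i : supported (flatten [seq l i | i <- enum I]) (F i).
  apply: supportedW (projT2 (cid (sF i))) => x xl; apply/flattenP.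
  by exists (l i) => //; apply: map_f; rewrite mem_enum.
rewrite (@fsum_seq _ (flatten [seq l i | i <- enum I])); last first.
  by move=> j jl; rewrite big1 // => i _; apply: sFl.
by rewrite exchange_big; apply: eq_bigr => i _; rewrite (fsum_seq (sFl i)).
Qed.

Lemma fsum_delta (V : nmodType) (i : T) (f : T -> V) :
  (forall j, j != i -> f j = 0) -> \sum_(j \in [set: T]) f j = f i.
Proof.
move=> f0; rewrite (@fsum_seq _ [:: i]) /= ?big_seq1 // => j.
by rewrite inE; apply: f0.
Qed.

Lemma uniform_lower_bound (l : seq T) (P : T -> int -> Prop) :
  (forall x (m n : int), m <= n -> P x n -> P x m) ->
  (forall x, exists n, P x n) -> exists n, forall x, x \in l -> P x n.
Proof.
move=> mono ex; elim: l => [|x l [n IH]]; first by exists 0.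
have [m Pm] := ex x; exists (Num.min m n) => y; rewrite inE => /orP[/eqP ->|yl].
  by apply: mono Pm; rewrite ge_min lexx.
by apply: mono (IH _ yl); rewrite ge_min lexx orbT.
Qed.
End FiniteSums.

Lemma exchange_fsum (T U : choiceType) (V : nmodType) (l : seq T) (l' : seq U)
    (F : T -> U -> V) :
  (forall i j, i \notin l -> F i j = 0) -> (forall i j, j \notin l' -> F i j = 0) ->
  \sum_(i \in [set: T]) \sum_(j \in [set: U]) F i j =
  \sum_(j \in [set: U]) \sum_(i \in [set: T]) F i j.
Proof.
move=> F1 F2; rewrite (@fsum_seq _ _ l); last first.
  by move=> i il; apply: fsum0 => j; apply: F1.
rewrite (@fsum_seq _ _ l'); last by move=> j jl; apply: fsum0 => i; apply: F2.
rewrite (eq_bigr (fun i => \sum_(j <- undup l') F i j)); last first.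
  by move=> i _; apply: fsum_seq => j; apply: F2.
rewrite exchange_big; apply: eq_bigr => j _; apply/esym.
by apply: fsum_seq => i; apply: F1.
Qed.

Definition zrange (N M : int) : seq int :=
  [seq N + i%:Z | i <- iota 0 `|M - N|%N].

Lemma mem_zrange (N M j : int) : N <= j -> j < M -> j \in zrange N M.
Proof.
move=> Nj jM; apply/mapP; exists `|j - N|%N; last by lia.
by rewrite mem_iota; lia.
Qed.

Lemma supported_zrange (V : nmodType) (N M : int) (f : int -> V) :
  (forall j, j < N -> f j = 0) -> (forall j, M <= j -> f j = 0) ->
  supported (zrange N M) f.
Proof.
move=> fN fM j jl; have [/fN //|Nj] := ltP j N; have [/fM //|jM] := leP M j.
by rewrite mem_zrange in jl.
Qed.

Lemma reindex_subz (V : nmodType) (k : int) (f : int -> V) :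
  \sum_(j \in [set: int]) f j = \sum_(j \in [set: int]) f (k - j).
Proof.
have inv : involutive (fun j : int => k - j) by move=> j; lia.
by apply: reindex_fsbigT; exists (fun j => k - j).
Qed.

Lemma reindex_addz (V : nmodType) (k : int) (f : int -> V) :
  \sum_(j \in [set: int]) f j = \sum_(j \in [set: int]) f (k + j).
Proof.
by apply: reindex_fsbigT; exists (fun j => j - k) => j; lia.
Qed.

(** * Laurent series and their inverses *)

Section LaurentSeries.
Variables (K : numClosedFieldType) (A : superalgebra K).
Implicit Types (f g h : lser A) (F : sfun A).

Definition bounded_below F := exists N : int, forall e k, k < N -> F e k = 0.

Lemma supported_lact f F (M N : int) e k :
  (forall j, j < M -> f j = 0) -> (forall j, j < N -> F e j = 0) ->
  supported (zrange M (k - N + 1)) (fun j => f j * F e (k - j)).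
Proof.
move=> fM FN; apply: supported_zrange => j jk; first by rewrite fM // mul0r.
by rewrite FN ?mulr0 //; lia.
Qed.

Lemma lact_order f F (M N : int) e :
  (forall j, j < M -> f j = 0) -> (forall j, j < N -> F e j = 0) ->
  forall k, k < M + N -> lact f F e k = 0.
Proof.
move=> fM FN k kMN; apply: fsum0 => j; have [/fM ->|Mj] := ltP j M.
  by rewrite mul0r.
by rewrite FN ?mulr0 //; lia.
Qed.

Lemma bounded_lact f F : laurent f -> bounded_below F -> bounded_below (lact f F).
Proof.
by move=> [M fM] [N FN]; exists (M + N) => e; apply: lact_order fM (FN e).
Qed.

Lemma lact1 F : lact (lone A) F = F.
Proof.
apply: funext => e; apply: funext => k; rewrite /lact (@fsum_delta _ _ 0) => [|j j0].
  by rewrite /lone eqxx mul1r subr0.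
by rewrite /lone (negPf j0) mul0r.
Qed.

Lemma lact_lmul f g F : laurent f -> laurent g -> bounded_below F ->
  lact (lmul f g) F = lact f (lact g F).
Proof.
move=> [M fM] [N gN] [P FP]; apply: funext => e; apply: funext => k; rewrite /lact.
transitivity (\sum_(n \in [set: int]) \sum_(i \in [set: int])
    f i * g (n - i) * F e (k - n)).
  apply: eq_fsum => n.
  apply: (@fsum_additive _ A A (fun x : A => x * F e (k - n)) (zrange M (n - N + 1))
    (fun i => f i * g (n - i))); first exact: mul0r.
    by move=> x y; apply: mulrDl.
  exact: (@supported_lact f (fun=> g)).
transitivity (\sum_(i \in [set: int]) \sum_(n \in [set: int])
    f i * g (n - i) * F e (k - n)); last first.
  apply: eq_fsum => i; rewrite [in RHS](reindex_addz (- i)).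
  rewrite (@fsum_additive _ A A ( *%R (f i)) (zrange (N + i) (k - P + 1))) ?mulr0 //.
  - by apply: eq_fsum => n; rewrite mulrA; congr (f i * g _ * F e _); lia.
  - by move=> x y; apply: mulrDr.
  apply: supported_zrange => j jk; first by rewrite gN ?mul0r //; lia.
  by rewrite FP ?mulr0 //; lia.
(* A nonzero term has M <= i, N <= n - i and P <= k - n, which bounds both indices on both sides. *)
apply: (@exchange_fsum _ _ _ (zrange (M + N) (k - P + 1)) (zrange M (k - P - N + 1))).
  move=> n i; move: n; apply: supported_zrange => n nk.
    have [/fM ->|Mi] := ltP i M; first by rewrite !mul0r.
    by rewrite gN ?mulr0 ?mul0r //; lia.
  by rewrite FP ?mulr0 //; lia.
move=> n i; move: i; apply: supported_zrange => i ik; first by rewrite fM // !mul0r.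
have [Pk|kP] := ltP (k - n) P; first by rewrite FP // mulr0.
by rewrite gN ?mulr0 ?mul0r //; lia.
Qed.

(** [lmul] is [lact] on a superfunction that does not depend on its exponent of theta. *)
Lemma lmulA f g h : laurent f -> laurent g -> laurent h ->
  lmul (lmul f g) h = lmul f (lmul g h).
Proof.
move=> Lf Lg [N hN]; have E : lact (lmul f g) (fun=> h) = lact f (lact g (fun=> h)).
  by apply: lact_lmul => //; exists N.
exact: (congr1 (fun F : sfun A => F true) E).
Qed.

Lemma lmul1l f : lmul (lone A) f = f.
Proof. exact: (congr1 (fun F : sfun A => F true) (lact1 (fun=> f))). Qed.

Lemma lmul1r f : lmul f (lone A) = f.
Proof.
apply: funext => k; rewrite /lmul (@fsum_delta _ _ k) => [|j jk].
  by rewrite /lone subrr eqxx mulr1.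
by rewrite /lone subr_eq0 eq_sym (negPf jk) mulr0.
Qed.

Lemma lser_right_inverse f (s : int) (c : A) :
  (forall k, k < s -> f k = 0) -> f s * c = 1 ->
  exists g, (forall k, k < - s -> g k = 0) /\ lmul f g = lone A.
Proof.
move=> fs fc.
(* [Gs n] lists the coefficients of g at -s, ..., -s + n - 1, and [next] solves the equation of
   degree [size G] in f g = 1 for the following one. *)
pose next (G : seq A) :=
  c * ((size G == 0)%N%:R - \sum_(i < size G) f (s + (size G - i)%N%:Z) * G`_i).
pose Gs n := iter n (fun G => rcons G (next G)) [::].
have sGs n : size (Gs n) = n by elim: n => //= n IH; rewrite size_rcons IH.
have nGs n i : (i < n)%N -> (Gs n)`_i = next (Gs i).
  elim: n => //= n IH; rewrite ltnS nth_rcons sGs leq_eqVlt.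
  by case: ltngtP => //= [/IH //|-> _].
pose g (k : int) := if - s <= k then next (Gs (absz (k + s))) else 0.
exists g; split=> [k ks|]; first by rewrite /g lt_geF.
apply: funext => k; rewrite /lmul.
have [k0|/gez0_abs kE] := ltP k 0.
  rewrite fsum0 ?/lone ?lt_eqF // => j; have [/fs ->|sj] := ltP j s.
    by rewrite mul0r.
  by rewrite /g lt_geF ?mulr0 //; lia.
move: `|k|%N kE => n <- {k}.
pose t (i : nat) := f (s + i%:Z) * g (n%:Z - (s + i%:Z)).
rewrite (@fsum_seq _ _ [seq s + i%:Z | i <- iota 0 n.+1]) => [|j]; last first.
  move=> jl; have [/fs ->|sj] := ltP j s; first by rewrite mul0r.
  rewrite /g lt_geF ?mulr0 //; rewrite ltNge; apply: contra jl => jn.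
  by apply/mapP; exists `|j - s|%N; rewrite ?mem_iota; lia.
rewrite undup_id ?map_inj_uniq ?iota_uniq //; last by move=> i j; lia.
rewrite big_map -/(index_iota 0 n.+1) big_nat_recl //=.
have -> : s + 0%:Z = s by lia.
have gE m : g (m%:Z - s) = next (Gs m).
  by rewrite /g ifT; last lia; congr (next (Gs _)); lia.
rewrite gE {1}/next sGs mulrA fc mul1r.
rewrite (_ : \sum_(0 <= i < n) _ = \sum_(i < n) f (s + (n - i)%N%:Z) * (Gs n)`_i).
  by rewrite subrK.
rewrite big_mkord (reindex_inj rev_ord_inj) /=; apply: eq_bigr => i _.
rewrite nGs // -gE; congr (f _ * g _); move: (ltn_ord i); lia.
Qed.

(** If g vanishes below k, the coefficient of f g at s + k is f_s g_k alone; comparing with 1 gives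
    g_k = 0 as long as k < -s. The induction starts from the bound N on the order of g. *)
Lemma lser_inverse_order f g (s : int) (c : A) :
  (forall k, k < s -> f k = 0) -> c * f s = 1 -> laurent g -> lmul f g = lone A ->
  (forall k, k < - s -> g k = 0) /\ g (- s) = c.
Proof.
move=> fs cf [N gN] fg.
have lead k : (forall j, j < k -> g j = 0) -> f s * g k = lone A (s + k).
  move=> gk; rewrite -fg /lmul (@fsum_delta _ _ s).
    by congr (_ * g _); lia.
  move=> j js; have [/fs ->|sj] := ltP j s; first by rewrite mul0r.
  by rewrite gk ?mulr0 //; lia.
have g0 : forall k, k < - s -> g k = 0.
  move=> k; have [/gN //|Nk] := ltP k N.
  have [n] : {n | n = `|k - N|%N} by exists `|k - N|%N.
  elim/ltn_ind: n k Nk => n IH k Nk nE ks; rewrite -[g k]mul1r -cf -mulrA lead.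
    by rewrite /lone (_ : (s + k == 0) = false) ?mulr0 //; lia.
  move=> j jk; have [/gN //|Nj] := ltP j N.
  by apply: (IH `|j - N|%N) => //; lia.
split=> //; rewrite -[g _]mul1r -cf -mulrA lead // /lone subrr eqxx mulr1 //.
Qed.

(** [linv] is specified as a right inverse only, over a noncommutative ring, whereas division needs
    a left inverse. Its leading coefficient is invertible as well, so it has a right inverse h in
    turn, and associativity forces f = h. *)
Lemma linvP f (s : int) :
  (forall k, k < s -> f k = 0) -> invertible (f s) ->
  (forall k, k < - s -> linv f k = 0) /\ lmul (linv f) f = lone A.
Proof.
move=> fs [c [fc cf]]; have [g [gs fg]] := lser_right_inverse fs fc.
have [Li fi] : [set g | laurent g /\ lmul f g = lone A] (linv f).
  by apply: xgetPex; exists g; split=> //; exists (- s).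
have [i0 ic] := lser_inverse_order fs cf Li fi; split=> //.
have [||h [hs ih]] := @lser_right_inverse (linv f) (- s) (f s) => //.
  by rewrite ic.
rewrite opprK in hs.
suff fh : f = h by rewrite {2}fh.
have Lf : laurent f by exists s.
have Lh : laurent h by exists s.
by rewrite -[f]lmul1r -ih -lmulA // fi lmul1l.
Qed.

End LaurentSeries.

(** * Coefficients in gamma *)

Section GammaCoefficients.
Variables (K : numClosedFieldType) (k l : nat).
Local Notation R := (base_ring K k l).
Local Notation S := (gamma_ring K k l).
Implicit Types (x y c : S) (d : nat).

Lemma gcoef0 d : gcoef d (0 : S) = 0.
Proof. exact: coef0. Qed.

Lemma gcoefD d : {morph @gcoef K k l d : x y / x + y}.
Proof. by move=> x y; apply: coefD. Qed.

Lemma gcoefN d : {morph @gcoef K k l d : x / - x}.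
Proof. by move=> x; apply: coefN. Qed.

Lemma gcoefB d : {morph @gcoef K k l d : x y / x - y}.
Proof. by move=> x y; rewrite gcoefD gcoefN. Qed.

Lemma gcoefP x y : (forall d, gcoef d x = gcoef d y) -> x = y.
Proof. by move=> xy; apply/polyP. Qed.

Lemma gcoefM d x y : gcoef d (x * y) = \sum_(i < d.+1) gcoef i x * gcoef (d - i) y.
Proof. exact: coefM. Qed.

Lemma gcoefM0 x y : gcoef 0 (x * y) = gcoef 0 x * gcoef 0 y.
Proof. by rewrite gcoefM big_ord1. Qed.

Lemma gcoef_const (c : R) d : gcoef d (const c) = if d == 0%N then c else 0.
Proof. exact: coefC. Qed.

Lemma gcoef_constM d (c : R) y : gcoef d (const c * y) = c * gcoef d y.
Proof. exact: coefCM. Qed.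

Lemma gcoef_signM d n x : gcoef d ((-1) ^+ n * x) = (-1) ^+ n * gcoef d x.
Proof.
by rewrite -signr_odd -[in RHS]signr_odd; case: (odd n); rewrite ?mulN1r ?gcoefN ?mul1r.
Qed.

Lemma gcoef_sum d (I : Type) (s : seq I) (P : pred I) (F : I -> S) :
  gcoef d (\sum_(i <- s | P i) F i) = \sum_(i <- s | P i) gcoef d (F i).
Proof. exact: (big_morph _ (@gcoefD d) (@gcoef0 d)). Qed.

Lemma gcoef_natM d n x : gcoef d (n%:R * x) = n%:R * gcoef d x.
Proof.
rewrite !mulr_natl; elim: n => [|n IH]; first by rewrite !mulr0n gcoef0.
by rewrite !mulrS gcoefD IH.
Qed.

Lemma gcoef_intM d (n : int) x : gcoef d (n%:~R * x) = n%:~R * gcoef d x.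
Proof.
case: n => n; first exact: gcoef_natM.
by rewrite NegzE !mulrNz !mulNr gcoefN -!pmulrn gcoef_natM.
Qed.

Lemma gcoef_fsum d (T : choiceType) (s : seq T) (F : T -> S) : supported s F ->
  gcoef d (\sum_(j \in [set: T]) F j) = \sum_(j \in [set: T]) gcoef d (F j).
Proof. by apply: (@fsum_additive T S R); [apply: gcoef0|apply: gcoefD]. Qed.

(** This makes the recursion triangular in gamma: if x and y agree in lower degrees, their
    difference in degree d meets only the gamma^0 part of the other factor. *)
Lemma gcoefMl_lead d c x y : (forall d', (d' < d)%N -> gcoef d' x = gcoef d' y) ->
  gcoef d (c * x) - gcoef d (c * y) = gcoef 0 c * (gcoef d x - gcoef d y).
Proof.
move=> xy; rewrite !gcoefM -sumrB big_ord_recl /= subn0 big1 ?addr0 ?mulrBr // => i _.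
by rewrite xy ?subrr //= /bump /=; move: (ltn_ord i); lia.
Qed.

Lemma gcoefMr_lead d c x y : (forall d', (d' < d)%N -> gcoef d' x = gcoef d' y) ->
  gcoef d (x * c) - gcoef d (y * c) = (gcoef d x - gcoef d y) * gcoef 0 c.
Proof.
move=> xy; rewrite !gcoefM -sumrB big_ord_recr /= subnn big1 ?add0r ?mulrBl // => i _.
by rewrite xy ?subrr.
Qed.

Lemma gcoefMl_eq d c x y : (forall d', (d' <= d)%N -> gcoef d' x = gcoef d' y) ->
  gcoef d (c * x) = gcoef d (c * y).
Proof.
by move=> xy; rewrite !gcoefM; apply: eq_bigr => i _; rewrite xy ?leq_subr.
Qed.

Lemma parityR0 : parity (0 : R) = 0.
Proof. exact: gparity0. Qed.

Lemma gcoef_parity d x : gcoef d (parity x) = parity (gcoef d x).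
Proof. exact/coef_map_id0/parityR0. Qed.

Lemma parityR1 : parity (1 : R) = 1.
Proof. exact: gparity_const. Qed.

Lemma parityRN (c : R) : parity (- c) = - parity c.
Proof. exact: gparityN. Qed.

Lemma iter_parityR0 n : iter n (@parity _ R) 0 = 0.
Proof. by elim: n => //= n ->; apply: parityR0. Qed.

Lemma parityS0 : parity (0 : S) = 0.
Proof. by apply: gcoefP => d; rewrite gcoef_parity !gcoef0 parityR0. Qed.

Lemma parity_const (c : R) : parity (const c) = const (parity c).
Proof.
apply: gcoefP => d; rewrite gcoef_parity !gcoef_const.
by case: ifP; rewrite ?parityR0.
Qed.

Lemma scalarR_mulrn (a : K) n : Defs.scalar R a *+ n = Defs.scalar R (a *+ n).
Proof.
elim: n => [|n IH]; last rewrite !mulrS IH; apply/ffunP => I; last first.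
  transitivity (gconst l (mpolyC k a) I + gconst l (mpolyC k (a *+ n)) I).
    exact: ffunE.
  by rewrite !ffunE; case: ifP => _; rewrite ?addr0 // -mpolyCD.
by rewrite !ffunE mulr0n mpolyC0 if_same.
Qed.

Lemma scalarR_natV n : n != 0%N -> Defs.scalar R n%:R^-1 * n%:R = 1.
Proof.
move=> n0; rewrite mulr_natr scalarR_mulrn -[_ *+ n]mulr_natl divff ?pnatr_eq0 //.
Qed.

Lemma scalarR_half : Defs.scalar R 2^-1 * 2%:R = 1.
Proof. exact: scalarR_natV. Qed.

Lemma scalarR0 : Defs.scalar R 0 = 0.
Proof. by have := scalarR_mulrn 0 0; rewrite mulr0n. Qed.

Lemma const1 : const (1 : R) = 1.
Proof. by []. Qed.

Lemma constD : {morph @const K k l : x y / x + y}.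
Proof. by move=> x y; rewrite /const polyCD. Qed.

Lemma constM : {morph @const K k l : x y / x * y}.
Proof. by move=> x y; rewrite /const polyCM. Qed.

Lemma scalarS_const a : Defs.scalar S a = const (Defs.scalar R a).
Proof. by []. Qed.

Lemma scalarS_half : Defs.scalar S 2^-1 * 2%:R = 1.
Proof. by have := congr1 (@const K k l) scalarR_half; rewrite constM !mulr2n constD. Qed.

Lemma doubleR_eq0 (y : R) : 2%:R * y = 0 -> y = 0.
Proof. by move=> y0; rewrite -[y]mul1r -scalarR_half -mulrA y0 mulr0. Qed.

Lemma even_comm (x y : R) : even_elt x -> x * y = y * x.
Proof.
apply: gparity_even_comm; rewrite -mpolyC_nat mpolyC_eq0 pnatr_eq0 //.
Qed.
End GammaCoefficients.

(** * The projection to the principal part *)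

Section PolarProjection.
Variables (K : numClosedFieldType) (k l r : nat) (C : curve_data K k l r).
Local Notation R := (base_ring K k l).
Local Notation S := (gamma_ring K k l).
Local Notation idx := (idx r).
Local Arguments Defs.scalar : simpl never.
Local Arguments parity : simpl never.
Implicit Types (i j : idx) (s t : seq idx) (w : mform S r).

(** In the domain |z| < |z_0| the kernel is a power series in its second argument. *)
Lemma Breg_right_neg i (a : 'I_r) e (m : int) : 0 < m -> Breg C i (a, e, - m) = 0.
Proof.
move=> m0; have [m1 m2 m3] : [/\ (0 < - m) = false, (0 <= - m) = false & (- m == 0) = false].
  by split; lia.
case: i => [[b e1] k1]; rewrite /Breg /B21 /eta0 /Bpolar21 /Breg0 /= m1 m2 m3 !andbF.
by case: e; case: e1; rewrite /= ?andbF ?if_same ?mulr0 ?addr0.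
Qed.

(* The zero mode term of B^reg cancels the one of B, as phi and V vanish with first
   index 0 and V is antisymmetric. *)
Lemma Breg_right_zero i (a : 'I_r) : super_spectral_curve C ->
  Breg C i (a, false, 0) = 0.
Proof.
case=> _ [_ [_ [_ [Cpar [Czero Csym]]]]].
have half (x : R) : Defs.scalar R 2^-1 * - x = - (Defs.scalar R (1 - 1 / 2) * x).
  suff -> : 1 - 1 / 2 = 2^-1 :> K by rewrite mulrN.
  by rewrite {1}[1]splitr addrK mul1r.
case: i => [[b e1] k1]; rewrite /Breg /B21 /eta0 /Bpolar21 /Breg0 /=.
rewrite !eqxx /= mulr1.
case: e1 => /=; rewrite ?andbF ?andbT ?add0r.
  case: ifP => _; last by rewrite parityR0 mulr0 addr0.
  have [_ -> _] := Cpar b a `|k1|%N 0%N.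
  by rewrite half subrr.
have [k1p|k1n|->] := ltgtP k1 0.
- by rewrite !addr0 (lt_eqF k1p) !andbF parityR0 mulr0 addr0.
- rewrite addr0 (gt_eqF k1n) andbF /= mul0r subr0 add0r.
  have [_ _ ->] := Cpar a b 0%N `|k1|%N.
  by have [_ ->] := Csym a b 0%N `|k1|%N; rewrite half subrr.
have [_ _ _ V00] := Czero b a 0%N.
rewrite addr0 eqxx !andbT absz0 V00 mulr0 addr0; case: (b == a) => /=.
  by rewrite parityR1 mulr1 addNr.
by rewrite parityR0 mulr0 addr0.
Qed.

Lemma Pkernel_nonneg i j : super_spectral_curve C -> 0 <= j.2 -> Pkernel C i j = 0.
Proof.
move=> HC; case: j => [[a e] m] /=; rewrite le_eqVlt => /orP[/eqP <-|m0].
  (* The index [(a, true, 0)] stands for [dz]/z; its kernel entry vanishes through the default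
     [0^-1 = 0]. *)
  case: e; first by rewrite mulr0z invr0 scalarR0 mul0r.
  by rewrite oppr0 Breg_right_zero // parityR0 oppr0.
by rewrite !Breg_right_neg // mulr0 parityR0 oppr0 if_same.
Qed.

(** Cauchy's formula: only the diagonal pole of B has polar coefficients in z_0. On the [dz] part
    its factor k cancels the 1/k of the primitive; on the [dtheta] part the sign of the expansion
    cancels that of the residue. *)
Lemma Pkernel_neg i j : i.2 < 0 -> Pkernel C i j = (i == j)%:R.
Proof.
case: i j => [[b e1] k1] [[a e] m] /= k10.
have BregE e' (n : int) : Breg C (b, e1, k1) (a, e', n) = Bpolar21 R (b, e1, k1) (a, e', n).
  rewrite /Breg /B21 /Breg0 /eta0 (lt_geF k10) (lt_gtF k10) (lt_eqF k10) /= !andbF.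
  by case: e1; case: e'; rewrite /= ?parityR0 ?mul0r mulr0 !addr0.
rewrite !BregE {BregE} /Bpolar21 !xpair_eqE -andbA.
have -> : (k1 + - m == 0) = (k1 == m) by rewrite subr_eq0.
case: (b == a) => /=; last by rewrite mulr0 parityR0 oppr0 if_same.
case: e; case: e1 => /=; rewrite ?mulr0 ?parityR0 ?oppr0 //.
  case: eqP => /= [mE|_]; rewrite ?mulr0 //; rewrite ifT; last by lia.
  have -> : - m = (`|m|%N)%:Z by lia.
  by rewrite -!pmulrn scalarR_natV //; lia.
case: eqP => /= [mE|_]; rewrite ?parityR0 ?oppr0 //; rewrite ifT; last by lia.
by rewrite parityRN opprK parityR1.
Qed.

Hypothesis HC : super_spectral_curve C.

Lemma gcoef_iter_parity_const d n (c : R) (x : S) :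
  gcoef d (iter n (@parity _ S) (const c) * x) = iter n (@parity _ R) c * gcoef d x.
Proof.
have -> : iter n (@parity _ S) (const c) = const (iter n (@parity _ R) c).
  by elim: n => //= n ->; rewrite parity_const.
exact: gcoef_constM.
Qed.

Lemma Pop_nth i0 p w s : (p < size s)%N ->
  Pop C p w s = \sum_(j \in [set: idx])
    iter (oddn (drop p.+1 s)) (@parity _ S) (Pkernel C (nth i0 s p) j)
    * w (take p s ++ j :: drop p.+1 s).
Proof. by move=> ps; rewrite /Pop /act (drop_nth i0). Qed.

Lemma Pop_nil p w s : (size s <= p)%N -> Pop C p w s = 0.
Proof. by move=> sp; rewrite /Pop /act drop_oversize. Qed.

Lemma iter_parityS0 n : iter n (@parity _ S) 0 = 0.
Proof. by elim: n => //= n ->; apply: parityS0. Qed.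

Lemma Pterm_nonneg n i j (x : S) : 0 <= j.2 ->
  iter n (@parity _ S) (Pkernel C i j) * x = 0.
Proof. by move=> j0; rewrite Pkernel_nonneg // iter_parityS0 mul0r. Qed.

Lemma take_cons_drop i0 s p : (p < size s)%N ->
  take p s ++ nth i0 s p :: drop p.+1 s = s.
Proof. by move=> ps; rewrite -drop_nth // cat_take_drop. Qed.

Lemma size_replace s p j : (p < size s)%N ->
  size (take p s ++ j :: drop p.+1 s) = size s.
Proof. by move=> ps; rewrite size_cat /= (size_takel (ltnW ps)) size_drop; lia. Qed.

Lemma nth_replace i0 s p q j : (p < size s)%N -> q != p ->
  nth i0 (take p s ++ j :: drop p.+1 s) q = nth i0 s q.
Proof.
move=> ps qp; rewrite nth_cat (size_takel (ltnW ps)); have [pq|pq] := ltnP q p.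
  by rewrite nth_take.
have -> : (q - p = (q - p.+1).+1)%N by lia.
by rewrite /= nth_drop; congr nth; lia.
Qed.

Lemma Pop_neg i0 p w s : (p < size s)%N -> (nth i0 s p).2 < 0 -> Pop C p w s = w s.
Proof.
move=> ps neg; rewrite (Pop_nth i0) // (@fsum_delta _ _ (nth i0 s p)) => [|j ji].
  rewrite Pkernel_neg // eqxx.
  have -> : iter (oddn (drop p.+1 s)) (@parity _ S) 1 = 1.
    by elim: (oddn _) => //= n ->; rewrite -const1 parity_const parityR1.
  by rewrite mul1r take_cons_drop.
by rewrite Pkernel_neg // eq_sym (negPf ji) iter_parityS0 mul0r.
Qed.

Definition polar_idx (N : int) : seq idx :=
  [seq (x, m) | x <- enum {: 'I_r * bool}, m <- zrange N 0].

Lemma mem_polar_idx N i : N <= i.2 -> i.2 < 0 -> i \in polar_idx N.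
Proof.
case: i => x m /= Nm m0; apply/allpairsP; exists (x, m).
by rewrite mem_enum mem_zrange.
Qed.

Lemma supported_Pop n (f : idx -> S) i N : (forall j, j.2 < N -> f j = 0) ->
  supported (polar_idx N) (fun j => iter n (@parity _ S) (Pkernel C i j) * f j).
Proof.
move=> fN j jN; have [/fN ->|Nj] := ltP j.2 N; first by rewrite mulr0.
have [j0|j0] := ltP j.2 0; last exact: (Pterm_nonneg n i (f j) j0).
by rewrite mem_polar_idx in jN.
Qed.

(* Iterated Laurent series in z_1, z_2, ..., as for an expansion in the domain
   |z_1| < |z_2| < ... *)
Definition bounded_form n w := forall s1, exists N : int, forall i s2,
  size (s1 ++ i :: s2) = n -> i.2 < N -> w (s1 ++ i :: s2) = 0.

Lemma bounded_form_at n w s p : bounded_form n w -> size s = n -> (p < n)%N ->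
  exists N : int, forall j, j.2 < N -> w (take p s ++ j :: drop p.+1 s) = 0.
Proof.
move=> bw sn pn; have [N wN] := bw (take p s); exists N => j; apply: wN.
by rewrite size_replace ?sn.
Qed.

(** If P acts before the slot to be bounded, the bound on w depends on the summation index j, but
    only finitely many polar j contribute, so a common bound exists. If P acts after that slot, the
    bound of w persists. If P acts on the slot itself, it fixes polar coefficients, hence the cut at
    [Num.min N 0]. *)
Lemma bounded_form_Pop n p w : bounded_form n w -> bounded_form n (Pop C p w).
Proof.
move=> bw s1; have [ps|sp|ps] := ltngtP p (size s1).
- have [i0 _] : exists i0 : idx, True by case: s1 ps => // i; exists i.
  have [N1 wN1] := bw (take p s1).
  have [||N wN] := @uniform_lower_bound _ (polar_idx N1) (fun j N =>
    forall i s2, size (s1 ++ i :: s2) = n -> i.2 < N ->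
      w (take p s1 ++ j :: drop p.+1 s1 ++ i :: s2) = 0).
  + by move=> j m m' mm H i s2 sn im; apply: H => //; apply: lt_le_trans im mm.
  + move=> j; have [N wN] := bw (take p s1 ++ j :: drop p.+1 s1).
    exists N => i s2 sn iN; rewrite -cat_cons catA; apply: wN => //.
    by rewrite -sn !size_cat; congr (_ + _)%N; rewrite -size_cat size_replace.
  exists N => i s2 sn iN; have pss : (p < size (s1 ++ i :: s2))%N.
    by rewrite size_cat; lia.
  rewrite (Pop_nth i0) //; apply: fsum0 => j.
  have -> : take p (s1 ++ i :: s2) = take p s1 by rewrite takel_cat // ltnW.
  have -> : drop p.+1 (s1 ++ i :: s2) = drop p.+1 s1 ++ i :: s2.
    rewrite drop_cat; have [//|ge] := ltnP p.+1 (size s1).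
    have -> : p.+1 = size s1 by lia.
    by rewrite subnn drop0 drop_size.
  have [j0|/Pterm_nonneg //] := ltP j.2 0.
  have [jN|Nj] := ltP j.2 N1; last by rewrite wN ?mulr0 // mem_polar_idx.
  rewrite wN1 ?mulr0 // -sn -[s1 in RHS](take_cons_drop i0 ps) -catA !size_cat /=.
  by rewrite !size_cat.
- have [N wN] := bw s1; exists N => i s2 sn iN.
  have [pss|/Pop_nil //] := ltnP p (size (s1 ++ i :: s2)).
  rewrite (Pop_nth i) //; apply: fsum0 => j.
  have := size_replace j pss; rewrite take_cat ltnNge (ltnW sp) /= sn.
  have -> : (p - size s1 = (p - size s1).-1.+1)%N by lia.
  by rewrite -catA => /= sn'; rewrite wN ?mulr0.
have [N wN] := bw s1; exists (Num.min N 0) => i s2 sn; rewrite lt_min => /andP[iN i0].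
rewrite (Pop_neg (i0 := i)) ?wN //; first by rewrite size_cat ps /=; lia.
by rewrite nth_cat ps ltnn subnn.
Qed.

Lemma bounded_form_Hop n p w : bounded_form n w -> bounded_form n (Hop C p w).
Proof.
move=> bw s1; have [N wN] := bw s1; have [N' PN] := bounded_form_Pop p bw s1.
exists (Num.min N N') => i s2 sn; rewrite lt_min => /andP[iN iN'].
by rewrite /Hop wN // PN // subr0.
Qed.

(** * Products of the projections H and P in several variables *)

Definition HPstep n (B : {set 'I_n}) (p : 'I_n) w : mform S r :=
  if p \in B then Pop C p w else Hop C p w.

Lemma HPopE n (B : {set 'I_n}) w : HPop C B w = foldr (HPstep B) w (enum 'I_n).
Proof. by []. Qed.

Lemma bounded_form_HPsteps n m (B : {set 'I_n}) w ps :
  bounded_form m w -> bounded_form m (foldr (HPstep B) w ps).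
Proof.
move=> bw; elim: ps => //= p ps IH; rewrite /HPstep; case: ifP => _.
  exact: bounded_form_Pop.
exact: bounded_form_Hop.
Qed.

Lemma eq_HPsteps n (B B' : {set 'I_n}) w ps : {in ps, B =i B'} ->
  foldr (HPstep B) w ps = foldr (HPstep B') w ps.
Proof.
elim: ps => //= p ps IH BB; rewrite IH => [|q qps]; last first.
  by apply: BB; rewrite inE qps orbT.
by rewrite /HPstep BB ?mem_head.
Qed.

(** The outermost operator is split off: applied to the same inner fold, [Hop] and [Pop] add up to
    the identity by the definition of [Hop]. Thus no linearity is involved here. *)
Lemma sum_HPsteps n (w : mform S r) (ps : seq 'I_n) s : uniq ps ->
  \sum_(B : {set 'I_n} | B \subset finset.finset (mem ps)) foldr (HPstep B) w ps s = w s.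
Proof.
elim: ps => [|p ps IH] /=.
  move=> _; rewrite (big_pred1 finset.set0) // => B.
  rewrite -[RHS]/(B == finset.set0) -finset.subset0.
  by congr (_ \subset _); apply/finset.setP => x; rewrite !inE.
case/andP=> pps ups; rewrite -[RHS](IH ups).
have -> : finset.finset (mem (p :: ps)) = finset.setU [set p]%SET (finset.finset (mem ps)).
  by apply/finset.setP => x; rewrite !inE.
rewrite big_subsetU1 ?inE //; apply: eq_bigr => B /fintype.subsetP sB.
have pB : p \notin B by apply: contra pps => /sB; rewrite inE.
rewrite /HPstep (negPf pB) finset.setU11 -/(HPstep B) -/(HPstep _).
rewrite (@eq_HPsteps _ (finset.setU [set p]%SET B) B) => [|q qps]; last first.
  by rewrite finset.in_setU1; case: eqP => // qp; rewrite -qp qps in pps.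
by rewrite /Hop subrK.
Qed.

(** Slot 0 is the head of the enumeration, so for B without 0 the operator H_0 is outermost in
    [HPop]. It is additive on bounded forms, and inside it the sum over B collapses to w by
    [sum_HPsteps]. *)
Lemma Hop_HPop n w s : bounded_form n.+1 w -> size s = n.+1 ->
  Hop C 0 w s = \sum_(B : {set 'I_n.+1} | ord0 \notin B) HPop C B w s.
Proof.
move=> bw sn; set ps := map (lift ord0) (enum 'I_n).
have ups : uniq ps by rewrite map_inj_uniq ?enum_uniq //; apply: lift_inj.
have i0 : idx by case: s sn.
have s0 : (0 < size s)%N by rewrite sn.
transitivity (\sum_(B : {set 'I_n.+1} | B \subset finset.finset (mem ps))
    Hop C 0 (foldr (HPstep B) w ps) s); last first.
  apply: eq_big => [B|B sB].
    apply/fintype.subsetP/idP => [sB|B0 x xB].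
      apply/negP => /sB; rewrite inE => /mapP[j _ /eqP]; apply/negP.
      exact: neq_lift.
    rewrite inE; case: (unliftP ord0 x) => [j ->|x0].
      by apply: map_f; rewrite mem_enum.
    by rewrite x0 (negPf B0) in xB.
  rewrite HPopE enum_ordSl /= /HPstep ifN //; apply/negP => /(fintype.subsetP sB).
  by rewrite inE => /mapP[j _ /eqP]; apply/negP; apply: neq_lift.
rewrite [RHS]sumrB sum_HPsteps //; congr (_ - _).
rewrite (Pop_nth i0) //.
rewrite [RHS](eq_bigr (fun B => _) (fun B _ => Pop_nth i0 (foldr (HPstep B) w ps) s0)).
rewrite -fsum_sum => [|B].
  by apply: eq_fsum => j; rewrite -mulr_sumr sum_HPsteps.
have [N wN] := bounded_form_at (bounded_form_HPsteps B ps bw) sn (ltn0Sn n).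
by exists (polar_idx N); apply: supported_Pop.
Qed.

(** * Agreement of two forms in a given degree in gamma *)

Definition polar_agree d n p w w' := forall s i0, size s = n ->
  (nth i0 s p).2 < 0 -> gcoef d (w' s) = gcoef d (w s).

Definition agree d n w w' := forall s, size s = n -> gcoef d (w' s) = gcoef d (w s).

Lemma Pkernel_const i j : exists c : R, Pkernel C i j = const c.
Proof. by case: j => [[a e] m]; eexists. Qed.

(** P acts degree by degree in gamma because its kernel is constant in gamma, and it reads only
    polar coefficients in its slot. *)
Lemma gcoef_Pop d p w w' s i0 (N N' : int) : (p < size s)%N ->
  (forall j, j.2 < N -> w (take p s ++ j :: drop p.+1 s) = 0) ->
  (forall j, j.2 < N' -> w' (take p s ++ j :: drop p.+1 s) = 0) ->
  (forall j, j.2 < 0 -> gcoef d (w' (take p s ++ j :: drop p.+1 s)) =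
                        gcoef d (w (take p s ++ j :: drop p.+1 s))) ->
  gcoef d (Pop C p w' s) = gcoef d (Pop C p w s).
Proof.
move=> ps wN wN' ww; rewrite !(Pop_nth i0) //.
rewrite (gcoef_fsum _ (supported_Pop _ _ wN)) (gcoef_fsum _ (supported_Pop _ _ wN')).
apply: eq_fsum => j; have [j0|/Pterm_nonneg E] := ltP j.2 0; last by rewrite !E.
have [c ->] := Pkernel_const (nth i0 s p) j.
by rewrite 2!gcoef_iter_parity_const (ww _ j0).
Qed.

Lemma agree_Pop d n p w w' : bounded_form n w -> bounded_form n w' -> (p < n)%N ->
  polar_agree d n p w w' -> agree d n (Pop C p w) (Pop C p w').
Proof.
move=> bw bw' pn ww s sn; have [i0 _] : exists i0 : idx, True.
  by case: s sn pn => [<-|i] //; exists i.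
have pss : (p < size s)%N by rewrite sn.
have [N wN] := bounded_form_at bw sn pn; have [N' wN'] := bounded_form_at bw' sn pn.
apply: (gcoef_Pop i0 pss wN wN') => j j0; apply: (ww _ i0); first by rewrite size_replace.
by rewrite nth_cat (size_takel (ltnW pss)) ltnn subnn.
Qed.

Lemma polar_agree_Pop d n p q w w' : bounded_form n w -> bounded_form n w' -> (p < n)%N ->
  (q < n)%N -> q != p -> polar_agree d n q w w' ->
  polar_agree d n q (Pop C p w) (Pop C p w').
Proof.
move=> bw bw' pn qn qp ww s i0 sn neg; have pss : (p < size s)%N by rewrite sn.
have [N wN] := bounded_form_at bw sn pn; have [N' wN'] := bounded_form_at bw' sn pn.
apply: (gcoef_Pop i0 pss wN wN') => j j0; apply: (ww _ i0); first by rewrite size_replace.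
by rewrite nth_replace.
Qed.

Lemma agree_polar d n p w w' : agree d n w w' -> polar_agree d n p w w'.
Proof. by move=> ww s i0 sn _; apply: ww. Qed.

Lemma HPsteps_polar_agree d n (B : {set 'I_n}) (ps : seq 'I_n) (q : 'I_n) w w' :
  bounded_form n w -> bounded_form n w' -> q \notin ps -> polar_agree d n q w w' ->
  polar_agree d n q (foldr (HPstep B) w ps) (foldr (HPstep B) w' ps).
Proof.
move=> bw bw' + ww; elim: ps => //= p ps IH; rewrite inE negb_or => /andP[qp qps].
have ? := bounded_form_HPsteps B ps bw.
have ? := bounded_form_HPsteps B ps bw'.
have PP := @polar_agree_Pop d n p q (foldr (HPstep B) w ps) (foldr (HPstep B) w' ps).
rewrite /HPstep; case: ifP => _ s i0 sn neg; first by apply: PP sn neg => //; apply: IH.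
by rewrite /Hop !gcoefB (IH qps s i0) // (PP _ _ _ _ _ (IH qps) s i0).
Qed.

(** Operators applied before P_q act in other slots and preserve agreement of the polar parts in
    slot q. P_q reads nothing else and turns this into full agreement, which the operators applied
    after it preserve. *)
Lemma HPsteps_agree d n (B : {set 'I_n}) (ps : seq 'I_n) (q : 'I_n) w w' :
  bounded_form n w -> bounded_form n w' -> uniq ps -> q \in ps -> q \in B ->
  polar_agree d n q w w' ->
  agree d n (foldr (HPstep B) w ps) (foldr (HPstep B) w' ps).
Proof.
move=> bw bw' + + qB ww; elim: ps => //= p ps IH /andP[pps ups].
have bF := bounded_form_HPsteps B ps bw.
have bF' := bounded_form_HPsteps B ps bw'.
rewrite inE; have [qp|_] := eqVneq q p => /= qps.
  rewrite -qp in pps *; rewrite {1 3}/HPstep qB; apply: agree_Pop => //.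
  exact: HPsteps_polar_agree.
have {}IH := IH ups qps.
have PP : agree d n (Pop C p (foldr (HPstep B) w ps)) (Pop C p (foldr (HPstep B) w' ps)).
  by apply: agree_Pop => //; apply: agree_polar.
by rewrite /HPstep; case: ifP => // _ s sn; rewrite /Hop !gcoefB PP // IH.
Qed.

(** An adjacent exchange carries the polar slot from p + 1 to p. The coefficients of omega_{0,2},
    expanded in |z_1| < |z_2|, are not graded symmetric themselves; v and v' stand for the parts
    without B, which have the same difference. *)
Lemma graded_symmetric_polar n w w' (v v' : mform S r) d :
  graded_symmetric n v -> graded_symmetric n v' -> (forall s, w' s - w s = v' s - v s) ->
  polar_agree d n 0 w w' -> forall p, (p < n)%N -> polar_agree d n p w w'.
Proof.
move=> gv gv' wv w0; elim=> [//|p IH] pn s i0 sn neg.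
have E t : gcoef d (w' t) - gcoef d (w t) = gcoef d (v' t) - gcoef d (v t).
  by rewrite -!gcoefB wv.
pose s1 := take p s; pose i := nth i0 s p; pose j := nth i0 s p.+1.
have sE : s = s1 ++ [:: i, j & drop p.+2 s].
  by rewrite /s1 /i /j -!drop_nth ?cat_take_drop // sn; lia.
have sn' : size (s1 ++ [:: j, i & drop p.+2 s]) = n.
  by rewrite -[RHS]sn [in RHS]sE !size_cat.
have sp : size s1 = p by rewrite size_takel // sn; lia.
have nth_j : nth i0 (s1 ++ [:: j, i & drop p.+2 s]) p = j.
  by rewrite nth_cat sp ltnn subnn.
have := IH (ltnW pn) _ i0 sn'; rewrite nth_j => /(_ neg) /eqP; rewrite -subr_eq0 E => /eqP W0.
apply/eqP; rewrite -subr_eq0 E [in v' _]sE [in v _]sE (gv' _ _ _ _ sn') (gv _ _ _ _ sn').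
by rewrite !gcoef_signM -mulrBr W0 mulr0.
Qed.

End PolarProjection.

(** * The Casimir of bounded bidifferentials *)

Section Casimir.
Variables (K : numClosedFieldType) (A : superalgebra K).
Implicit Types (G : bisfun A).

Definition bounded_below2 G := exists N : int, forall e1 k1 e2 k2,
  (k1 < N) || (k2 < N) -> G e1 k1 e2 k2 = 0.

Lemma bounded_Dstar1 G : bounded_below2 G -> bounded_below2 (Dstar1 G).
Proof.
move=> [N GN]; exists N => e1 k1 e2 k2 kN.
by rewrite /Dstar1 !GN // mulr0 if_same.
Qed.

Lemma bounded_z12_mul G : bounded_below2 G -> bounded_below2 (z12_mul G).
Proof.
move=> [N GN]; exists N => e1 k1 e2 k2 kN.
by rewrite /z12_mul !GN ?subr0 //; lia.
Qed.

Lemma bounded_th1z1_mul G : bounded_below2 G -> bounded_below2 (th1z1_mul G).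
Proof.
move=> [N GN]; exists N => e1 k1 e2 k2 kN.
by rewrite /th1z1_mul GN ?if_same //; lia.
Qed.

Definition restr_term (b1 b2 : bool) G e1 k1 e2 k2 : A :=
  sigma_sign A b1 e1 k1 * sigma_sign A b2 e2 k2 * G e1 k1 e2 k2.

Lemma supported_restr b1 b2 G (e : bool) k N :
  (forall e1 k1 e2 k2, (k1 < N) || (k2 < N) -> G e1 k1 e2 k2 = 0) ->
  supported (zrange N (k - N + 1)) (fun j =>
    if e then restr_term b1 b2 G true j false (k - j)
              + restr_term b1 b2 G false j true (k - j)
    else restr_term b1 b2 G false j false (k - j)).
Proof.
move=> GN; apply: supported_zrange => j jN; rewrite /restr_term !GN; try by lia.
  by rewrite !mulr0 addr0 if_same.
by rewrite !mulr0 addr0 if_same.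
Qed.

Lemma bounded_restr b1 b2 G : bounded_below2 G -> bounded_below (restr b1 b2 G).
Proof.
move=> [N GN]; exists (N + N) => e k kN; apply: fsum0 => j.
by rewrite !GN ?mulr0 ?addr0 ?if_same //; lia.
Qed.

Lemma bounded_casimir G : bounded_below2 G -> bounded_below (casimir G).
Proof.
move=> /bounded_Dstar1 bG.
have [N1 H1] := bounded_restr false true bG; have [N2 H2] := bounded_restr true false bG.
exists (Num.min N1 N2) => e k; rewrite lt_min => /andP[k1 k2].
by rewrite /casimir H1 // H2 // subr0 mulr0.
Qed.

Lemma bounded_casimir_diag p G : bounded_below2 G -> bounded_below (casimir_diag p G).
Proof.
move=> bG; rewrite /casimir_diag; set Nd := (X in restr false true X).
have bNd : bounded_below2 Nd.
  have [N1 H1] := bounded_z12_mul (bounded_Dstar1 bG).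
  have [N2 H2] := bounded_th1z1_mul bG.
  exists (Num.min N1 N2) => e1 k1 e2 k2 kN.
  by rewrite /Nd H1 ?H2 ?mulr0 ?subr0 //; move: kN; rewrite !lt_min; lia.
have [N1 H1] := bounded_restr false true bNd; have [N2 H2] := bounded_restr true false bNd.
exists (Num.min N1 N2 - p.+1%:Z) => e k kN.
by rewrite H1 ?H2 ?mulr0 ?subr0 ?mulr0 //; move: kN; rewrite ltrBrDr lt_min; lia.
Qed.

Lemma bounded_Bnum : bounded_below2 (@Bnum K A).
Proof.
exists 0 => e1 k1 e2 k2 kN; rewrite /Bnum.
have [-> -> ->] : [/\ (k1 == 1) && (k2 == 1) = false, (k1 == 2) && (k2 == 0) = false &
  (k1 == 0) && (k2 == 2) = false] by split; lia.
by rewrite !andbF.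
Qed.

Lemma restrB b1 b2 G G' e k : bounded_below2 G -> bounded_below2 G' ->
  restr b1 b2 G e k - restr b1 b2 G' e k =
  restr b1 b2 (fun e1 k1 e2 k2 => G e1 k1 e2 k2 - G' e1 k1 e2 k2) e k.
Proof.
move=> [N GN] [N' GN'].
have sG := supported_restr b1 b2 e (k := k) GN.
have sG' := supported_restr b1 b2 e (k := k) GN'.
rewrite -[LHS](fsumB sG sG'); apply: eq_fsum => j /=; rewrite /restr_term.
by case: (e); rewrite !mulrBr // opprD addrACA.
Qed.

Lemma Dstar1B G G' : (fun e1 k1 e2 k2 => Dstar1 G e1 k1 e2 k2 - Dstar1 G' e1 k1 e2 k2) =
  Dstar1 (fun e1 k1 e2 k2 => G e1 k1 e2 k2 - G' e1 k1 e2 k2).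
Proof.
apply: funext => e1; apply: funext => k1; apply: funext => e2; apply: funext => k2.
by rewrite /Dstar1; case: e1 => //=; rewrite mulrBr.
Qed.

Lemma casimirB G G' e k : bounded_below2 G -> bounded_below2 G' ->
  casimir G e k - casimir G' e k =
  casimir (fun e1 k1 e2 k2 => G e1 k1 e2 k2 - G' e1 k1 e2 k2) e k.
Proof.
move=> /bounded_Dstar1 bG /bounded_Dstar1 bG'.
rewrite /casimir -mulrBr -Dstar1B -!restrB //; congr (_ * _).
by rewrite !opprB addrACA [RHS]addrACA; congr (_ + _); rewrite addrC.
Qed.
End Casimir.

(** * Compatibility of the Casimir with taking coefficients in gamma *)

Section CasimirGamma.
Variables (K : numClosedFieldType) (k l : nat).
Local Notation R := (base_ring K k l).
Local Notation S := (gamma_ring K k l).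
Implicit Types (G : bisfun S).

Definition gcoef2 d G : bisfun R := fun e1 k1 e2 k2 => gcoef d (G e1 k1 e2 k2).

Lemma bounded_gcoef2 d G : bounded_below2 G -> bounded_below2 (gcoef2 d G).
Proof. by move=> [N GN]; exists N => e1 k1 e2 k2 kN; rewrite /gcoef2 GN // gcoef0. Qed.

Lemma sigma_signE (A : superalgebra K) b e m :
  sigma_sign A b e m = (-1) ^+ (if b then e + `|m| else 0)%N.
Proof. by case: b => //=; rewrite exprD. Qed.

Lemma gcoef_restr d b1 b2 G e m : bounded_below2 G ->
  gcoef d (restr b1 b2 G e m) = restr b1 b2 (gcoef2 d G) e m.
Proof.
move=> [N GN]; rewrite /restr (gcoef_fsum _ (supported_restr b1 b2 e (k := m) GN)).
apply: eq_fsum => j /=; rewrite /restr_term.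
by case: e; rewrite ?gcoefD !sigma_signE -!exprD !gcoef_signM.
Qed.

Lemma gcoef_casimir d G e m : bounded_below2 G ->
  gcoef d (casimir G e m) = casimir (gcoef2 d G) e m.
Proof.
move=> /bounded_Dstar1 bG.
have DG : Dstar1 (gcoef2 d G) = gcoef2 d (Dstar1 G).
  apply: funext => e1; apply: funext => k1; apply: funext => e2; apply: funext => k2.
  by rewrite /gcoef2 /Dstar1; case: e1; rewrite ?gcoef_intM.
have E b1 b2 : gcoef d (restr b1 b2 (Dstar1 G) e m) = restr b1 b2 (Dstar1 (gcoef2 d G)) e m.
  by rewrite DG; exact: (gcoef_restr d b1 b2 e m bG).
rewrite {2}/casimir -!E -gcoefB; exact: gcoef_constM.
Qed.
End CasimirGamma.

(** * The loop equations near a puncture *)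

Section LoopEquations.
Variables (K : numClosedFieldType) (k l r : nat) (C : curve_data K k l r).
Local Notation R := (base_ring K k l).
Local Notation S := (gamma_ring K k l).
Local Notation idx := (idx r).
Variable yg : 'I_r -> lser S.
Implicit Types (i j : idx) (s t : seq idx) (w : multidiff_family K k l r).
Local Arguments Defs.scalar : simpl never.
Local Arguments parity : simpl never.

Hypothesis HC : super_spectral_curve C.
Hypothesis Hsimple : simple_curve C.
Hypothesis Hyg : rescaled C yg.

(* [dphi]^2 Delta ytilde *)
Definition dyform (a : 'I_r) : lser S := dphi2 (fun m => const (cDytilde C a m)).

Lemma dyformE a m : dyform a m = 2%:R * const (cDytilde C a (m - 2)).
Proof. by []. Qed.

Lemma dyform_order a m : m < (cs C a)%:Z -> dyform a m = 0.
Proof.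
move=> ms; have [Y0 _] := Hsimple a.
by rewrite dyformE Y0 ?mulr0 //; lia.
Qed.

Lemma dyform_lead a : invertible (dyform a (cs C a)%:Z).
Proof.
have [_ [y [xy yx]]] := Hsimple a; rewrite dyformE.
have two (x : S) : 2%:R * x = x * 2%:R by rewrite mulr_natl mulr_natr.
exists (const y * Defs.scalar S 2^-1); split.
  by rewrite -mulrA [const _ * (_ * _)]mulrA -constM xy const1 mul1r two scalarS_half.
by rewrite -mulrA [_ * (2%:R * _)]mulrA scalarS_half mul1r -constM yx.
Qed.

Lemma laurent_dyform a : laurent (dyform a).
Proof. by exists (cs C a)%:Z => m; apply: dyform_order. Qed.

Lemma linv_dyform a :
  (forall m, m < - (cs C a)%:Z -> linv (dyform a) m = 0) /\
  lmul (linv (dyform a)) (dyform a) = lone S.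
Proof. by apply: linvP (dyform_lead a) => m; apply: dyform_order. Qed.

(** The factors sqrt2 and the shifts of exponents cancel, and theta squares to zero: phi D_phi is
    the projection to the theta^1 component, so 2 - phi D_phi is 2 on theta^0 and 1 on theta^1. *)
Lemma phiDphi3E (E : sfun S) e m : phiDphi3 E e m = if e then E true m else 0.
Proof.
rewrite /phiDphi3 /phimul; case: e => //.
rewrite /Dphi /Dstar mulrA !scalarS_const -constM.
suff -> : Defs.scalar R (sqrtC 2%:R) * Defs.scalar R (sqrtC 2%:R)^-1 = 1.
  by rewrite const1 mul1r; congr E; lia.
apply/ffunP => I; rewrite gconstM !ffunE; case: ifP => _; last by rewrite mulr0.
by rewrite -mpolyCM divff ?mpolyC1 // sqrtC_eq0 pnatr_eq0.
Qed.

Lemma E1E w a g s e m :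
  E1 w a g s e m = (1 - (-1) ^+ (e + `|m|)%N) * w g ((a, e, m) :: s).
Proof. by rewrite /E1 /sigma_form sigma_signE mulrBl mul1r mulNr. Qed.

Lemma DeltaE w a g s e m :
  Delta (w g) a s e m = (1 + (-1) ^+ (e + `|m|)%N) * w g ((a, e, m) :: s).
Proof. by rewrite /Delta /sigma_form sigma_signE mulrDl mul1r mulNr opprK. Qed.

(** The diagonal pole pairs z_1^k with z_2^(-k) for all k >= 0, so the order in the second variable
    is bounded only once the first exponent is fixed. *)
Lemma bounded_form_B n g :
  bounded_form n (fun s => if (g, s) is (0%N, [:: i; j]) then const (B12 C i j) else 0).
Proof.
have B0 i j : (i.2 < 0) || (j.2 < Num.min 0 (- i.2)) -> B12 C i j = 0.
  case: i => [[a e1] k1]; case: j => [[b e2] k2] /=; rewrite lt_min => H.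
  rewrite /B12 /Bpolar12 /Breg0.
  have [k10|k10] := ltP k1 0.
    rewrite (lt_gtF k10) (lt_eqF k10) !if_same add0r.
    by case: (e1); case: (e2).
  have [k20 k12] : k2 < 0 /\ (k1 + k2 == 0) = false by move: H; lia.
  rewrite k12 !andbF (lt_gtF k20) (lt_geF k20) !andbF add0r.
  by case: e1; case: e2.
case: g => [|g]; last by exists 0.
case=> [|i [|i' s1]]; last by exists 0 => i'' s2; case: s1.
- exists 0 => i [|j [|j' s2]] //= _ i0.
  by rewrite B0 ?i0.
- exists (Num.min 0 (- i.2)) => j [|j' s2] //= _ j0.
  by rewrite B0 // j0 orbT.
Qed.

Lemma bounded_laurent_form n (v : mform S r) : laurent_form n v -> bounded_form n v.
Proof.
move=> [[N vN] _] s1; exists N => i s2 sn iN; apply: vN => //.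
by rewrite has_cat /= iN orbT.
Qed.

Lemma bounded_form_symmetric w g n : symmetric_family C w -> (0 < 2 * g + n)%N ->
  bounded_form n.+1 (w g).
Proof.
move=> sw gn; have [Lv _ _] := sw g n gn; move: Lv => /bounded_laurent_form bv s1.
have [N vN] := bv s1; have [N' BN] := bounded_form_B n.+1 g s1.
exists (Num.min N N') => i s2 sn; rewrite lt_min => /andP[iN iN'].
have := vN i s2 sn iN; rewrite /regular_part; have := BN i s2 sn iN'.
by move=> /= ->; rewrite subr0.
Qed.

Lemma bounded_slot0 w g s : symmetric_family C w -> (0 < 2 * g + size s)%N ->
  exists N : int, forall i, i.2 < N -> w g (i :: s) = 0.
Proof.
move=> sw gn; have [N wN] := bounded_form_symmetric sw gn [::].
by exists N => i; apply: wN.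
Qed.

Lemma bounded_below_slot0 w g s a : symmetric_family C w -> (0 < 2 * g + size s)%N ->
  bounded_below (fun e m => w g ((a, e, m) :: s)).
Proof.
by move=> sw gn; have [N wN] := bounded_slot0 sw gn; exists N => e m; apply: (wN (a, e, m)).
Qed.

Lemma uniform_ord (P : 'I_r -> int -> Prop) :
  (forall x (m n : int), m <= n -> P x n -> P x m) ->
  (forall x, exists n, P x n) -> exists n, forall x, P x n.
Proof.
move=> mono ex; have [n nP] := uniform_lower_bound (enum 'I_r) mono ex.
by exists n => x; apply: nP; rewrite mem_enum.
Qed.

Lemma laurent_clambda a : laurent (clambda C a).
Proof.
have [/(_ a)[_ _ _ [N tN]] _] := HC; exists (N - 1) => m mN.
by rewrite /clambda tN ?mulr0 //; lia.
Qed.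

Lemma bounded_with_omega01 w g s : symmetric_family C w ->
  exists N : int, forall i, i.2 < N -> with_omega01 C yg w g (i :: s) = 0.
Proof.
move=> sw; have [gn|] := ltnP 0 (2 * g + size s).
  have [N wN] := bounded_slot0 sw gn; exists N => i iN.
  rewrite /with_omega01 ifN ?wN //=; apply/negP; lia.
case: g => [|g]; last by lia.
case: s => [|i s] //= _.
have [||N NP] := @uniform_ord (fun a N => forall e m, m < N ->
    omega01g C yg [:: (a, e, m)] = 0).
- by move=> a m n mn H e j jm; apply: H; apply: lt_le_trans jm mn.
- move=> a; have [[N1 H1] _ _ _] := Hyg a; have [N2 H2] := laurent_clambda a.
  exists (Num.min (N1 + 2) (N2 + 1)) => e m mN /=; case: e.
    by rewrite H1 ?mulr0 //; move: mN; rewrite lt_min; lia.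
  rewrite H2; last by move: mN; rewrite lt_min; lia.
  by rewrite /const polyC0 !mulr0.
by exists N => [[[a e] m]] /= mN; apply: NP.
Qed.

Definition bounded_biform (T : idx -> idx -> S) := exists N : int, forall i j,
  (i.2 < N) || (j.2 < N) -> T i j = 0.

Lemma bounded_biform_fun a T : bounded_biform T -> bounded_below2 (biform_fun a T).
Proof.
by move=> [N TN]; exists N => e1 k1 e2 k2 kN; rewrite /biform_fun TN ?mulr0.
Qed.

Lemma bounded_biform_sum (I : Type) (x : seq I) (F : I -> idx -> idx -> S) :
  (forall y, bounded_biform (F y)) -> bounded_biform (fun i j => \sum_(y <- x) F y i j).
Proof.
move=> bF; elim: x => [|y x [N IH]]; first by exists 0 => i j _; rewrite big_nil.
have [N' FN] := bF y; exists (Num.min N N') => i j ijN.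
rewrite big_cons IH ?FN ?addr0 //; move: ijN; rewrite !lt_min; lia.
Qed.

Lemma bounded_tensor w g1 g2 (m : seq bool) s : symmetric_family C w ->
  bounded_biform (fun i j =>
    tensor (with_omega01 C yg w g1) (with_omega01 C yg w g2) m i j s).
Proof.
move=> sw; have [N1 H1] := bounded_with_omega01 g1 (mask m s) sw.
have [N2 H2] := bounded_with_omega01 g2 (mask (map negb m) s) sw.
exists (Num.min N1 N2) => i j; rewrite /tensor !lt_min => /orP[]/andP[n1 n2].
  by rewrite H1 // iter_parityS0 mulr0 mul0r.
by rewrite H2 // mulr0.
Qed.

(** The second summand of [E2], isolated because it alone contains omega_{g,n+1}, through the
    products with omega_{0,1}; [E2_glue] is of lower order in 2g + n. *)
Definition stable_tensors w g s (i j : idx) : S :=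
  \sum_(g1 < g.+1) \sum_(m : (size s).-tuple bool)
    tensor (with_omega01 C yg w g1) (with_omega01 C yg w (g - g1)%N) m i j s.

Definition E2_glue w a g s : sfun S := fun e m =>
  if g is g'.+1 then
    if (g' == 0%N) && nilp s then
      casimir (biform_fun a (fun i1 i2 => w 0%N [:: i1; i2] - Bpolar12 S i1 i2)) e m
      + casimir_diag 2 (@Bnum K S) e m
    else casimir (biform_fun a (fun i1 i2 => w g' [:: i1, i2 & s])) e m
  else 0.

Lemma E2E w a g s e m :
  E2 C yg w a g s e m = E2_glue w a g s e m + casimir (biform_fun a (stable_tensors w g s)) e m.
Proof. by []. Qed.

Lemma bounded_stable_tensors w g s : symmetric_family C w ->
  bounded_biform (stable_tensors w g s).
Proof.
move=> sw; rewrite /stable_tensors.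
have [N FN] := bounded_biform_sum (enum 'I_g.+1) (fun g1 => bounded_biform_sum
  (enum {: (size s).-tuple bool}) (fun m => bounded_tensor g1 (g - g1) m s sw)).
exists N => i j /FN F0; rewrite -[RHS]F0 big_enum; apply: eq_big => // g1 _.
by rewrite big_enum; apply: eq_bigl.
Qed.

(** Among the forms met here only omega_{0,2} is unbounded in its two slots jointly. For it, [E2]
    subtracts the polar part of B, whose Casimir is the separate [casimir_diag]. *)
Lemma bounded_E2_glue w a g s : symmetric_family C w -> bounded_below (E2_glue w a g s).
Proof.
move=> sw; rewrite /E2_glue; case: g => [|g']; first by exists 0.
case: (boolP ((g' == 0%N) && nilp s)) => [_|nz].
  have bT : bounded_biform (fun i j => w 0%N [:: i; j] - Bpolar12 S i j).
    have [[[N vN] _] _ _] := sw 0%N 1%N isT.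
    exists (Num.min N 0) => [[[a1 e1] k1]] [[a2 e2] k2] ijN.
    have := vN [:: (a1, e1, k1); (a2, e2, k2)] erefl; rewrite /regular_part /= orbF => V.
    have V0 : (k1 < N) || (k2 < N) by move: ijN => /=; rewrite !lt_min; lia.
    have Bp : const (Bpolar12 R (a1, e1, k1) (a2, e2, k2)) =
        Bpolar12 S (a1, e1, k1) (a2, e2, k2).
      rewrite /Bpolar12; case: ifP => _; last exact: polyC0.
      case: (e1); case: ifP => _; rewrite ?const1 ?polyC0 //; last first.
        by case: ifP.
      by rewrite /const rmorph_int.
    have Br : Breg0 C (a1, e1, k1) (a2, e2, k2) = 0.
      have : (k1 < 0) || (k2 < 0) by move: ijN => /=; rewrite !lt_min; lia.
      rewrite /Breg0; move=> /orP[k0|k0]; rewrite (lt_gtF k0) (lt_geF k0) ?andbF;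
        by case: (e1); case: (e2).
    by have := V V0; rewrite /B12 Br addr0 Bp.
  have [N1 H1] := bounded_casimir (bounded_biform_fun a bT).
  have [N2 H2] := bounded_casimir_diag 2 (@bounded_Bnum K S).
  exists (Num.min N1 N2) => e m; rewrite lt_min => /andP[m1 m2].
  by rewrite H1 // H2 // addr0.
apply/bounded_casimir/bounded_biform_fun.
have gs : (0 < 2 * g' + (size s).+1)%N by lia.
have [[[N vN] _] _ _] := sw g' (size s).+1 gs; exists N => i j ijN.
have := vN [:: i, j & s] erefl; rewrite /= orbA ijN => /(_ isT).
rewrite /regular_part; case: g' nz {vN gs} => [|g'] nz; last by rewrite subr0.
by case: s nz => [//|? ?] _; rewrite subr0.
Qed.

Lemma bounded_E2 w a g s : symmetric_family C w -> bounded_below (E2 C yg w a g s).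
Proof.
move=> sw; have [N1 H1] := bounded_E2_glue a g s sw.
have [N2 H2] := bounded_casimir (bounded_biform_fun a (bounded_stable_tensors g s sw)).
exists (Num.min N1 N2) => e m; rewrite lt_min => /andP[m1 m2].
by rewrite E2E H1 // H2 // addr0.
Qed.

Lemma bounded_Delta w a g s : symmetric_family C w -> (0 < 2 * g + size s)%N ->
  bounded_below (Delta (w g) a s).
Proof.
move=> sw gn; have [N wN] := bounded_below_slot0 a sw gn.
by exists N => e m mN; rewrite DeltaE wN // mulr0.
Qed.

Lemma bounded_Rec w a g s : symmetric_family C w -> (0 < 2 * g + size s)%N ->
  bounded_below (Rec C yg w a g s).
Proof.
move=> sw gn; have [N1 H1] := bounded_E2 a g s sw.
have [N2 H2] := bounded_lact (laurent_dyform a) (bounded_Delta a sw gn).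
exists (Num.min N1 N2) => e m; rewrite lt_min => /andP[m1 m2].
by rewrite /Rec phiDphi3E !H1 // H2 // !mulr0 if_same subr0 addr0.
Qed.

(** Below the order allowed by the linear loop equation, omega_{g,n+1} is anti-invariant under
    sigma_a. The sign here is that of - sigma^*, as sigma^* [dtheta] = - [dtheta]. *)
Lemma E1_order w a g s (e : bool) m : linear_loop_equations w -> (0 < 2 * g + size s)%N ->
  m < 1 + (e : nat)%:Z -> (-1) ^+ (e + `|m|)%N * w g ((a, e, m) :: s) = w g ((a, e, m) :: s).
Proof.
move=> lw gn me; have := lw a g s gn e m; rewrite addr0 => /(_ me).
by rewrite E1E mulrBl mul1r => /eqP; rewrite subr_eq0 => /eqP.
Qed.

Lemma half_lact_dyform a (F : sfun S) e m : bounded_below F ->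
  Defs.scalar S 2^-1 * lact (dyform a) F e m =
  \sum_(j \in [set: int]) const (cDytilde C a (j - 2)) * F e (m - j).
Proof.
move=> [N FN]; rewrite (@fsum_additive _ S S ( *%R (Defs.scalar S 2^-1))
  (zrange (cs C a)%:Z (m - N + 1))) ?mulr0 //.
- by apply: eq_fsum => j; rewrite dyformE !mulrA scalarS_half mul1r.
- by move=> x y; apply: mulrDr.
by apply: supported_lact (FN e) => j; apply: dyform_order.
Qed.

Lemma Rec_loop w a g s e m : symmetric_family C w -> super_loop_equations C yg w ->
  (0 < 2 * g + size s)%N -> m < (cs C a)%:Z ->
  Rec C yg w a g s e m = lact (dyform a) (fun e m => w g ((a, e, m) :: s)) e m.
Proof.
move=> sw [lw qw] gn ms.
have E20 e' : E2 C yg w a g s e' m = 0.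
  by apply: qw => //; apply: lt_le_trans ms _; case: e'; lia.
rewrite /Rec phiDphi3E !E20 mulr0 if_same subr0 add0r.
rewrite half_lact_dyform; last exact: bounded_Delta.
apply: eq_fsum => j; have [jc|jc] := ltP j (cs C a)%:Z.
  have [Y0 _] := Hsimple a; rewrite dyform_order // Y0 ?polyC0 ?mul0r //; lia.
(* Here j >= s_a > m, so m - j is negative and the linear loop equation applies. *)
rewrite DeltaE mulrDl mul1r E1_order //; last by case: e; lia.
by rewrite dyformE -mulrA mulr_natl mulr2n mulrDr.
Qed.

Definition polar_form w g : mform S r := fun s =>
  if s is (a, e, m) :: s' then lact (linv (dyform a)) (Rec C yg w a g s') e m else 0.

Local Arguments polar_form : simpl never.

Lemma P0_rhsE w g : P0_rhs C yg w g = Pop C 0 (polar_form w g).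
Proof. by []. Qed.

(** The inverse of D has order -s_a, so a coefficient of negative order of Rec / D involves Rec only
    below the order s_a, where [Rec_loop] replaces it by D omega. *)
Lemma polar_form_loop w g i s : symmetric_family C w -> super_loop_equations C yg w ->
  (0 < 2 * g + size s)%N -> i.2 < 0 -> polar_form w g (i :: s) = w g (i :: s).
Proof.
case: i => [[a e] m] sw lw gn /= m0; have [l0 lD] := linv_dyform a.
have bw := bounded_below_slot0 a sw gn.
have Ll : laurent (linv (dyform a)) by exists (- (cs C a)%:Z).
transitivity (lact (linv (dyform a)) (lact (dyform a) (fun e m => w g ((a, e, m) :: s))) e m).
  apply: eq_fsum => j; have [/l0 ->|jc] := ltP j (- (cs C a)%:Z); first by rewrite !mul0r.
  by rewrite Rec_loop //; lia.
by rewrite -lact_lmul // ?lD ?lact1 //; apply: laurent_dyform.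
Qed.

Lemma Pop_loop w g n s : symmetric_family C w -> super_loop_equations C yg w ->
  (0 < 2 * g + n)%N -> size s = n.+1 -> Pop C 0 (w g) s = P0_rhs C yg w g s.
Proof.
move=> sw lw gn; case: s => // i s [sn]; rewrite P0_rhsE !(Pop_nth _ i) //= drop0.
apply: eq_fsum => j; have [j0|j0] := ltP j.2 0; last by rewrite !Pterm_nonneg.
by rewrite polar_form_loop // sn.
Qed.

Lemma bounded_polar_form w g s : symmetric_family C w -> (0 < 2 * g + size s)%N ->
  exists N : int, forall i, i.2 < N -> polar_form w g (i :: s) = 0.
Proof.
move=> sw gn; have [||N NP] := @uniform_ord (fun a N => forall e m, m < N ->
    polar_form w g ((a, e, m) :: s) = 0).
- by move=> a m n mn H e j jm; apply: H; apply: lt_le_trans jm mn.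
- move=> a; have [l0 _] := linv_dyform a.
  by apply: bounded_lact; [exists (- (cs C a)%:Z)|apply: bounded_Rec].
by exists N => [[[a e] m]] /= mN; apply: NP.
Qed.

(* [dphi]^2 Delta ytilde has order s_a and the kernel annihilates holomorphic forms,
   so that only the orders of Rec^a below s_a contribute to the residue. *)
Lemma gcoef_P0_rhs d w w' g n s : symmetric_family C w -> symmetric_family C w' ->
  (0 < 2 * g + n)%N -> size s = n.+1 ->
  (forall a e m s' d', (d' <= d)%N -> size s' = n -> m < (cs C a)%:Z ->
     gcoef d' (Rec C yg w' a g s' e m) = gcoef d' (Rec C yg w a g s' e m)) ->
  gcoef d (P0_rhs C yg w' g s) = gcoef d (P0_rhs C yg w g s).
Proof.
move=> sw sw' gn; case: s => // i s [sn] RR; rewrite !P0_rhsE.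
have gs : (0 < 2 * g + size s)%N by rewrite sn.
have [N HN] := bounded_polar_form sw gs; have [N' HN'] := bounded_polar_form sw' gs.
apply: (@gcoef_Pop _ _ _ _ C HC d 0 _ _ (i :: s) i N N') => //=; rewrite ?drop0 ?take0 //.
move=> [[a e] m] /= m0; have [l0 _] := linv_dyform a.
have sup w0 : symmetric_family C w0 -> exists x : seq int, supported x
    (fun j : int => linv (dyform a) j * Rec C yg w0 a g s e (m - j)).
  move=> sw0; have [M HM] := bounded_Rec a sw0 gs.
  by eexists; apply: supported_lact l0 (HM e).
have [x sx] := sup w sw; have [x' sx'] := sup w' sw'.
rewrite /polar_form /lact (gcoef_fsum d sx) (gcoef_fsum d sx'); apply: eq_fsum => j.
have [/l0 ->|jc] := ltP j (- (cs C a)%:Z); first by rewrite !mul0r.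
by apply: gcoefMl_eq => d' d'd; apply: RR => //; lia.
Qed.

(* In degree 0 in gamma only the [dz] part of omega_{0,1} is left, as lambda is
   multiplied by gamma. *)
Definition dominant (a : 'I_r) (m : int) : R := 2%:R * gcoef 0 (yg a (m - 2)).

Lemma zsignE (A : superalgebra K) (m : int) : zsign A m = if odd `|m| then -1 else 1.
Proof. by rewrite /zsign -signr_odd; case: (odd _). Qed.

Lemma odd_absz_sub2 (m : int) : odd `|m - 2|%N = odd `|m|%N.
Proof. lia. Qed.

Lemma gcoef0_gvar (x : S) : gcoef 0 (gvar K k l * x) = 0.
Proof. by rewrite /gcoef /gvar coefXM. Qed.

(** Every term of the correction in ytilde contains the rescaled Delta lambda, hence a factor gamma.
    Vanishing at gamma = 0 is stable under sums, so no information on the inverse of Delta y is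
    required. *)
Lemma cDytilde_gcoef0 a m : cDytilde C a m = gcoef 0 (ldelta (yg a) m).
Proof.
have [_ _ _ /(congr1 (fun f => gcoef 0 (f m)))] := Hyg a.
rewrite gcoef_const eqxx => <-; rewrite /tilde gcoefD.
set x := (X in _ + X); suff -> : x = 0 by rewrite addr0.
rewrite /x; apply: (fsum_ind (P := fun y => gcoef 0 y = 0)).
- exact: gcoef0.
- by move=> y z y0 z0; rewrite gcoefD y0 z0 addr0.
move=> j; rewrite gcoefM0; set y := (X in X * _); suff -> : y = 0 by rewrite mul0r.
rewrite /y; apply: (fsum_ind (P := fun y => gcoef 0 y = 0)).
- exact: gcoef0.
- by move=> z t z0 t0; rewrite gcoefD z0 t0 addr0.
by move=> n; rewrite gcoefM0 gcoef0_gvar mulr0.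
Qed.

Lemma dominant_odd a m : odd `|m| -> dominant a m = cDytilde C a (m - 2).
Proof.
move=> om; rewrite cDytilde_gcoef0 /ldelta zsignE odd_absz_sub2 om mulN1r opprK.
by rewrite gcoefD /dominant mulr_natl mulr2n.
Qed.

Lemma cDytilde_even a m : ~~ odd `|m| -> cDytilde C a (m - 2) = 0.
Proof.
move=> em; rewrite cDytilde_gcoef0 /ldelta zsignE odd_absz_sub2 (negPf em) mul1r.
by rewrite subrr gcoef0.
Qed.

(** Rescaling keeps y(z) + y(-z), and the curve condition on omega_{0,1} + sigma^* omega_{0,1} kills
    the coefficients of this sum for m < 1; an even m < 2 is at most 0. *)
Lemma dominant_even a m : ~~ odd `|m| -> m < 2 -> dominant a m = 0.
Proof.
move=> em m2; have [_ _ sumy _] := Hyg a.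
have := congr1 (gcoef 0) (sumy (m - 2)).
rewrite gcoef_const eqxx !zsignE odd_absz_sub2 (negPf em) !mul1r gcoefD.
rewrite /dominant [in X in _ -> X]mulr_natl [X in _ -> X = _]mulr2n => ->.
have [_ [_ [Csum _]]] := HC; have := Csum a true m.
rewrite /omega01 /sigma_form sigma_signE add1n -signr_odd /= em expr1 opprK mul1r /cy.
have -> : m - 2 + 2 = m by lia.
move=> t0; rewrite -mulrDr t0 ?mulr0 //; lia.
Qed.

Lemma dominant_comm a m (x : R) : x * dominant a m = dominant a m * x.
Proof.
rewrite /dominant; set y := gcoef 0 _.
rewrite mulr_natl mulrnAr mulrnAl; congr (_ *+ _); apply/esym/even_comm.
have [_ /(_ (m - 2)) ev _ _] := Hyg a.
by rewrite /even_elt -gcoef_parity ev.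
Qed.

Lemma bounded_dominant : exists N : int, forall a m, m < N -> dominant a m = 0.
Proof.
apply: uniform_ord => [a m n mn H j jm|a]; first by apply: H; apply: lt_le_trans jm mn.
have [[N yN] _ _ _] := Hyg a; exists (N + 2) => m mN.
by rewrite /dominant yN ?gcoef0 ?mulr0 //; lia.
Qed.

Lemma gcoef_iter_parity p d' (x : S) :
  gcoef d' (iter p (@parity _ S) x) = iter p (@parity _ R) (gcoef d' x).
Proof. by elim: p => //= p <-; rewrite gcoef_parity. Qed.

Lemma gcoef0_omega01g n i : gcoef 0 (iter n (@parity _ S) (omega01g C yg [:: i])) =
  if i.1.2 then dominant i.1.1 i.2 else 0.
Proof.
rewrite gcoef_iter_parity; case: i => [[a e] m] /=.
case: e; last by rewrite gcoefM0 gcoef0_gvar mulr0 iter_parityR0.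
rewrite gcoef_natM -/(dominant a m).
have [_ /(_ (m - 2)) ev _ _] := Hyg a.
elim: n => //= n ->; rewrite /dominant; set y := gcoef 0 _.
have {}ev : parity y = y by rewrite -gcoef_parity ev.
rewrite mulr_natl mulr2n -[in RHS]ev; apply: gparityD.
Qed.

(** * Variation of Rec between two candidates that agree in lower orders *)

Section Step.
Variables (w w' : multidiff_family K k l r) (g n d : nat).
Hypothesis (sw : symmetric_family C w) (sw' : symmetric_family C w').
Hypothesis (lw : linear_loop_equations w) (lw' : linear_loop_equations w').
Hypothesis gn : (0 < 2 * g + n)%N.
Hypothesis ww : agree_below w w' g n d.

Lemma with_omega01_agree g' t i : (2 * g' + size t < 2 * g + n)%N ->
  with_omega01 C yg w' g' (i :: t) = with_omega01 C yg w g' (i :: t).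
Proof.
move=> lt; rewrite /with_omega01; case: ifP => // /negbT; rewrite /= eqSS => gt.
apply: gcoefP => d'; apply: (ww (n' := size t)) => //; last by left.
by move: gt; case: (g') => [|?]; case: (t) => [|? ?] //=; lia.
Qed.

Lemma E2_glue_agree a s e m : size s = n -> E2_glue w' a g s e m = E2_glue w a g s e m.
Proof.
move=> sn; rewrite /E2_glue; case: g gn ww => // g' gn' ww'.
have eqw i1 i2 : w' g' [:: i1, i2 & s] = w g' [:: i1, i2 & s].
  by apply: gcoefP => d'; apply: (ww' g' n.+1) => //=; rewrite ?sn; lia.
have -> : (fun i1 i2 => w' g' [:: i1, i2 & s]) = (fun i1 i2 => w g' [:: i1, i2 & s]).
  by apply: funext => i1; apply: funext => i2.
case: ifP => // /andP[/eqP g0 /nilP s0]; congr (casimir (biform_fun a _) e m + _).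
by apply: funext => i1; apply: funext => i2; rewrite g0 s0 in eqw; rewrite eqw.
Qed.

Variable s : seq idx.
Hypothesis sn : size s = n.

Definition top_diff i : R := gcoef d (w' g (i :: s)) - gcoef d (w g (i :: s)).

Lemma low_agree i d' : (d' < d)%N -> gcoef d' (w' g (i :: s)) = gcoef d' (w g (i :: s)).
Proof. by move=> d'd; apply: (ww (n' := n)) => //=; rewrite ?sn //; right. Qed.

Local Arguments omega01g : simpl never.

Lemma unshuffle_nseq b t : unshuffle (nseq (size t) b) t = 0%N.
Proof.
elim: t => //= i t IH; case: b IH => IH; first by rewrite IH.
by rewrite IH mask_false muln0.
Qed.

Lemma with_omega01_top w0 i : with_omega01 C yg w0 g (i :: s) = w0 g (i :: s).
Proof.
rewrite /with_omega01 ifN //= eqSS sn; apply/negP => /andP[/eqP g0 /eqP n0].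
by move: gn; rewrite g0 n0.
Qed.

(** A product can contain omega_{g,n+1} only if its other factor is omega_{0,1}: g1 = 0 with the
    mask all false, or g1 = g with the mask all true. Every other product has factors of lower
    order, equal by [ww]. In degree d the variation meets only the gamma^0 part of omega_{0,1},
    which is even, so no sign remains. *)
Lemma tensor_diff g1 (m : (size s).-tuple bool) i j : (g1 <= g)%N ->
  gcoef d (tensor (with_omega01 C yg w' g1) (with_omega01 C yg w' (g - g1)%N) m i j s) -
  gcoef d (tensor (with_omega01 C yg w g1) (with_omega01 C yg w (g - g1)%N) m i j s) =
  (if (g1 == 0%N) && (m == [tuple of nseq (size s) false])
   then (if i.1.2 then dominant i.1.1 i.2 * top_diff j else 0) else 0) +
  (if (g1 == g) && (m == [tuple of nseq (size s) true])
   then (if j.1.2 then dominant j.1.1 j.2 * top_diff i else 0) else 0).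
Proof.
move=> g1g; have sm := size_tuple m.
have cm : (count id m + count negb m = size s)%N by rewrite -[RHS]sm -(count_predC id).
have mf : count id m = 0%N -> m = [tuple of nseq (size s) false].
  move=> c0; apply: val_inj => /=.
  suff /all_pred1P : all (pred1 false) m by rewrite sm.
  rewrite all_count (etrans sm (esym cm)) c0 add0n; apply/eqP; apply: eq_count => b /=.
  by rewrite eqbF_neg.
have mt : count negb m = 0%N -> m = [tuple of nseq (size s) true].
  move=> c0; apply: val_inj => /=.
  suff /all_pred1P : all (pred1 true) m by rewrite sm.
  rewrite all_count (etrans sm (esym cm)) c0 addn0; apply/eqP; apply: eq_count => b /=.
  by rewrite eqb_id.
have [/andP[/eqP g10 /eqP mE]|nA] := boolP ((g1 == 0%N) && _).
  (* Both exceptional cases hold together only for g = 0 and s empty, which [gn] excludes. *)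
  rewrite [X in _ = _ + X]ifN; last first.
    rewrite g10 mE; apply/negP => /andP[/eqP g0 /eqP].
    move=> /(congr1 (fun t : (size s).-tuple bool => has id t)).
    rewrite /= !has_nseq andbT andbF => s0.
    by move: gn; rewrite -g0 -sn muln0 add0n -s0.
  rewrite addr0 g10 mE subn0 /tensor /= mask_false map_nseq /= mask_true //.
  rewrite unshuffle_nseq mul0n expr0 !mul1r !with_omega01_top.
  rewrite /with_omega01 /=.
  rewrite gcoefMl_lead; last by move=> d'; apply: low_agree.
  by rewrite gcoef0_omega01g; case: ifP => _; rewrite ?mul0r.
rewrite add0r.
have [/andP[/eqP g1E /eqP mE]|nB] := boolP ((g1 == g) && _).
  rewrite g1E mE subnn /tensor /= map_nseq /= mask_true // mask_false.
  rewrite unshuffle_nseq !addn0 !with_omega01_top.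
  rewrite /with_omega01 /=.
  rewrite -[X in gcoef d X - _]mulrA -[X in _ - gcoef d X]mulrA.
  rewrite !gcoef_signM -mulrBr gcoefMr_lead; last first.
    by move=> d' d'd; rewrite !gcoef_iter_parity low_agree.
  rewrite (gcoef0_omega01g 0 j) !gcoef_iter_parity /isodd.
  case: (j.1.2) => /=; last by rewrite !mulr0.
  by rewrite muln0 expr0 mul1r dominant_comm.
have lt1 : (2 * g1 + size (mask m s) < 2 * g + n)%N.
  rewrite size_mask // -sn; have : (g1 != g) || (count negb m != 0%N).
    by rewrite -negb_and; apply: contra nB => /andP[-> /eqP/mt ->] /=.
  lia.
have lt2 : (2 * (g - g1) + size (mask (map negb m) s) < 2 * g + n)%N.
  rewrite size_mask ?size_map // count_map -sn.
  have : (g1 != 0%N) || (count id m != 0%N).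
    by rewrite -negb_and; apply: contra nA => /andP[-> /eqP/mf ->] /=.
  have -> : count (preim negb id) m = count negb m by apply: eq_count.
  lia.
by rewrite /tensor !with_omega01_agree // subrr.
Qed.

Lemma stable_tensors_diff i j :
  gcoef d (stable_tensors w' g s i j) - gcoef d (stable_tensors w g s i j) =
  (if i.1.2 then dominant i.1.1 i.2 * top_diff j else 0) +
  (if j.1.2 then dominant j.1.1 j.2 * top_diff i else 0).
Proof.
have sum_if (T : finType) (t : T) (x : R) : \sum_u (if u == t then x else 0) = x.
  by rewrite -big_mkcond big_pred1_eq.
rewrite /stable_tensors !gcoef_sum -sumrB.
under eq_bigr do rewrite !gcoef_sum -sumrB.
rewrite (eq_bigr (fun g1 : 'I_g.+1 => (if g1 == ord0
  then (if i.1.2 then dominant i.1.1 i.2 * top_diff j else 0) else 0) +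
  (if g1 == ord_max
  then (if j.1.2 then dominant j.1.1 j.2 * top_diff i else 0) else 0))).
  by rewrite big_split /= !sum_if.
move=> g1 _; rewrite (eq_bigr _ (fun m _ => tensor_diff m i j (leq_ord g1))) big_split /=.
rewrite -!val_eqE /=; congr (_ + _).
  by case: (val g1 == 0%N) => /=; rewrite ?sum_if // big1.
by case: (val g1 == g) => /=; rewrite ?sum_if // big1.
Qed.

Lemma bounded_top_diff : exists N : int, forall i, i.2 < N -> top_diff i = 0.
Proof.
have gs : (0 < 2 * g + size s)%N by rewrite sn.
have [N wN] := bounded_slot0 sw gs; have [N' wN'] := bounded_slot0 sw' gs.
exists (Num.min N N') => i; rewrite lt_min => /andP[iN iN'].
by rewrite /top_diff wN // wN' // subrr.
Qed.

Lemma top_diff_order a (e : bool) (m : int) : m < 1 + (e : nat)%:Z ->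
  (-1) ^+ (e + `|m|)%N * top_diff (a, e, m) = top_diff (a, e, m).
Proof.
move=> me; have gs : (0 < 2 * g + size s)%N by rewrite sn.
by rewrite /top_diff mulrBr -!gcoef_signM !E1_order.
Qed.

(* The anti-invariant part of omega_{0,1} is cancelled by the last term of Rec^a; the
   invariant parts have order at least 2 and 1, and s_a <= 3. *)
Lemma residual_term a (e : bool) (m j : int) : m < (cs C a)%:Z ->
  ((-1) ^+ `|j|%N - (-1) ^+ (e + `|m - j|)%N) * (dominant a j * top_diff (a, e, m - j))
  + cDytilde C a (j - 2) * ((1 + (-1) ^+ (e + `|m - j|)%N) * top_diff (a, e, m - j)) = 0.
Proof.
move=> mc; have m3 : m < 3.
  by have [_ [/(_ a)[cs13 _ _] _]] := HC; move: mc; case: cs13 => ->; lia.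
have signE p : (-1) ^+ p = (if odd p then -1 else 1) :> R.
  by rewrite -signr_odd; case: (odd p).
have [oj|ej] := boolP (odd `|j|).
  rewrite -(dominant_odd a oj) !signE oj; case: (odd _).
    by rewrite !subrr !mul0r mulr0 addr0.
  move: (dominant a j) (top_diff _) => D u.
  by rewrite mulrBl mulN1r mulrDl !mul1r mulrDr addrACA !addNr addr0.
rewrite (cDytilde_even a ej) mul0r addr0.
have [j2|j2] := ltP j 2; first by rewrite dominant_even // mul0r mulr0.
have m1 : m - j < 1 + (e : nat)%:Z by case: (e); lia.
have := top_diff_order a m1; rewrite !signE (negPf ej); case: (odd _) => [|_].
  rewrite mulN1r => /eqP; rewrite eq_sym -subr_eq0 opprK -mulr2n -mulr_natl => /eqP u0.
  by rewrite (doubleR_eq0 u0) !mulr0.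
by rewrite subrr mul0r.
Qed.

Definition top_biform a : bisfun R := fun e1 k1 e2 k2 =>
  (-1) ^+ e1 * ((if e1 then dominant a k1 * top_diff (a, e2, k2) else 0) +
                (if e2 then dominant a k2 * top_diff (a, e1, k1) else 0)).

Lemma bounded_top_biform a : bounded_below2 (top_biform a).
Proof.
have [N1 dN] := bounded_dominant; have [N2 tN] := bounded_top_diff.
exists (Num.min N1 N2) => e1 k1 e2 k2; rewrite !lt_min /top_biform.
move=> /orP[]/andP[n1 n2].
  by rewrite (dN a k1) // (tN (a, e1, k1)) // mulr0 mul0r !if_same addr0 mulr0.
by rewrite (dN a k2) // (tN (a, e2, k2)) // mulr0 mul0r !if_same addr0 mulr0.
Qed.

Lemma gcoef_E2_diff a e m :
  gcoef d (E2 C yg w' a g s e m) - gcoef d (E2 C yg w a g s e m) =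
  casimir (top_biform a) e m.
Proof.
rewrite !E2E E2_glue_agree // !gcoefD opprD addrACA subrr add0r.
have bs w0 (sw0 : symmetric_family C w0) :=
  bounded_biform_fun a (bounded_stable_tensors g s sw0).
have -> : top_biform a = fun e1 k1 e2 k2 =>
    gcoef2 d (biform_fun a (stable_tensors w' g s)) e1 k1 e2 k2 -
    gcoef2 d (biform_fun a (stable_tensors w g s)) e1 k1 e2 k2.
  apply: funext => e1; apply: funext => k1; apply: funext => e2; apply: funext => k2.
  by rewrite /gcoef2 /biform_fun !gcoef_signM -mulrBr stable_tensors_diff.
rewrite (gcoef_casimir d e m (bs w sw)) (gcoef_casimir d e m (bs w' sw')).
exact: casimirB (bounded_gcoef2 d (bs w' sw')) (bounded_gcoef2 d (bs w sw)).
Qed.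

Lemma supported_top a e m : exists x : seq int,
  supported x (fun j : int => dominant a j * top_diff (a, e, m - j)).
Proof.
have [N1 dN] := bounded_dominant; have [N2 tN] := bounded_top_diff.
exists (zrange N1 (m - N2 + 1)).
by apply: (supported_lact (F := fun e m => top_diff (a, e, m))) => j jN;
  [apply: dN|apply: (tN (a, e, j))].
Qed.

(** The weight on the left is that of 2 - phi D_phi. In the theta^0 component D* leaves one of the
    two products; in the theta^1 component both remain and are exchanged by j -> m - j, which
    compensates the 1/2 of the Casimir. *)
Lemma casimir_top a e m :
  (if e then 1 else 2%:R) * casimir (top_biform a) e m =
  \sum_(j \in [set: int]) ((-1) ^+ `|j|%N - (-1) ^+ (e + `|m - j|)%N)
                          * (dominant a j * top_diff (a, e, m - j)).
Proof.
have two (x : R) : 2%:R * (Defs.scalar R 2^-1 * x) = x.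
  by rewrite mulrA mulr_natl -mulr_natr scalarR_half mul1r.
have [N bN] := bounded_Dstar1 (bounded_top_biform a).
have s1 := supported_restr false true e (k := m) bN.
have s2 := supported_restr true false e (k := m) bN.
have diff : restr false true (Dstar1 (top_biform a)) e m
    - restr true false (Dstar1 (top_biform a)) e m =
  \sum_(j \in [set: int]) ((-1) ^+ `|j|%N - (-1) ^+ (e + `|m - j|)%N) *
    (dominant a j * top_diff (a, e, m - j)
     + if e then dominant a (m - j) * top_diff (a, e, j) else 0).
  rewrite -[LHS](fsumB s1 s2); apply: eq_fsum => j.
  have alg0 (A : nzRingType) (x y z : A) :
      (-1) ^+ 0 * x * (-1 * (-1) ^+ 0 * (z + 0))
      - y * (-1) ^+ 0 * (-1 * (-1) ^+ 0 * (z + 0)) = (y - x) * (z + 0).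
    by rewrite expr0 !mulr1 !mul1r !mulN1r !mulrN opprK -mulNr -mulrDl addrC.
  have alg1 (A : nzRingType) (x y z t : A) :
      (-1) ^+ 0 * x * (t * ((-1) ^+ 0 * (0 + 0)))
      + (-1) ^+ 0 * (-1 * x) * (-1 * (-1) ^+ 0 * z)
      - (-1 * y * (-1) ^+ 0 * (t * ((-1) ^+ 0 * (0 + 0)))
         + y * (-1) ^+ 0 * (-1 * (-1) ^+ 0 * z)) = (y - -1 * x) * z.
    rewrite expr0 addr0 !mulr0 !add0r !mulr1 !mul1r !mulN1r.
    by rewrite !mulNr !mulrN !opprK -mulrDl addrC.
  rewrite /restr_term !sigma_signE /Dstar1 /top_biform /= !add0n !add1n.
  by case: (e); rewrite /= ?add0n ?add1n ?exprS; [apply: alg1|apply: alg0].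
rewrite /casimir diff; case: (e) => /=; last first.
  by rewrite two; apply: eq_fsum => j; rewrite addr0.
have [x sx] := supported_top a true m.
pose A (j : int) : R := ((-1) ^+ `|j|%N - (-1) ^+ `|m - j|%N.+1)
  * (dominant a j * top_diff (a, true, m - j)).
have sA : supported x A by move=> j /sx; rewrite /A => ->; rewrite mulr0.
(* The sign factor is symmetric in j and m - j. *)
have BA (j : int) : ((-1) ^+ `|j|%N - (-1) ^+ `|m - j|%N.+1)
    * (dominant a (m - j) * top_diff (a, true, j)) = A (m - j).
  rewrite /A; have -> : m - (m - j) = j by lia.
  have alg (B : nzRingType) (u v : B) : u - -1 * v = v - -1 * u.
    by rewrite !mulN1r !opprK addrC.
  by rewrite !exprS alg.
have sB : supported [seq m - j | j : int <- x] (fun j : int => A (m - j)).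
  move=> j jx; apply: sA; apply: contra jx => jx; apply/mapP; exists (m - j) => //.
  by lia.
rewrite mul1r; transitivity (Defs.scalar R 2^-1 * \sum_(j \in [set: int]) (A j + A (m - j))).
  congr (_ * _); apply: eq_fsum => j.
  exact: etrans (mulrDr _ _ _) (congr1 (+%R (A j)) (BA j)).
have half (x0 : R) : Defs.scalar R 2^-1 * (x0 + x0) = x0.
  by have -> : x0 + x0 = 2%:R * x0; rewrite ?mulrA ?scalarR_half ?mul1r // mulr_natl mulr2n.
have AA : \sum_(j \in [set: int]) (A j + A (m - j)) =
    \sum_(j \in [set: int]) A j + \sum_(j \in [set: int]) A j.
  exact: etrans (fsumD sA sB) (congr1 (+%R _) (esym (reindex_subz m A))).
rewrite AA half; apply: eq_fsum => j; exact: erefl.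
Qed.

(** The variation of Rec is a sum over j in which the weighted Casimir and D Delta omega / 2 pair up
    termwise into the left-hand side of [residual_term]. *)
Lemma gcoef_Rec_agree a e m : m < (cs C a)%:Z ->
  gcoef d (Rec C yg w' a g s e m) = gcoef d (Rec C yg w a g s e m).
Proof.
move=> mc; have gs : (0 < 2 * g + size s)%N by rewrite sn.
have RecE w0 : symmetric_family C w0 -> Rec C yg w0 a g s e m =
    (if e then 1 else 2%:R) * E2 C yg w0 a g s e m + \sum_(j \in [set: int])
      const (cDytilde C a (j - 2)) * Delta (w0 g) a s e (m - j).
  move=> sw0; rewrite /Rec half_lact_dyform; last exact: bounded_Delta.
  rewrite phiDphi3E; congr (_ + _); case: (e); last by rewrite subr0.
  by rewrite mul1r mulr_natl mulr2n addrK.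
have Dsup w0 : symmetric_family C w0 -> exists x : seq int, supported x
    (fun j : int => const (cDytilde C a (j - 2)) * Delta (w0 g) a s e (m - j)).
  move=> sw0; have [N DN] := bounded_Delta a sw0 gs.
  exists (zrange (cs C a)%:Z (m - N + 1)).
  have H (j : int) : j < (cs C a)%:Z -> const (cDytilde C a (j - 2)) = 0.
    by move=> jc; have [Y0 _] := Hsimple a; rewrite Y0 ?polyC0 //; lia.
  exact: (@supported_lact _ S _ (Delta (w0 g) a s) _ _ e m H (DN e)).
have [x sx] := Dsup w sw; have [x' sx'] := Dsup w' sw'.
apply/eqP; rewrite -subr_eq0 (RecE w sw) (RecE w' sw') !gcoefD.
have subrACA (B : zmodType) (x1 x2 x3 x4 : B) : x1 + x2 - (x3 + x4) = x1 - x3 + (x2 - x4).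
  by rewrite opprD addrACA.
rewrite (gcoef_fsum d sx) (gcoef_fsum d sx') subrACA.
have -> (y z : S) : gcoef d ((if e then 1 else 2%:R) * y)
    - gcoef d ((if e then 1 else 2%:R) * z) = (if e then 1 else 2%:R) * (gcoef d y - gcoef d z).
  by case: (e); rewrite ?mul1r // !gcoef_natM mulrBr.
rewrite gcoef_E2_diff casimir_top.
have [y sy] := supported_top a e m.
have sgcoef w0 x0 : supported x0 (fun j : int =>
    const (cDytilde C a (j - 2)) * Delta (w0 g) a s e (m - j)) ->
  supported x0 (fun j : int =>
    gcoef d (const (cDytilde C a (j - 2)) * Delta (w0 g) a s e (m - j))).
  by move=> sx0 j /sx0 ->; apply: gcoef0.
rewrite -(fsumB (sgcoef _ _ sx') (sgcoef _ _ sx)) -(@fsumD _ _ y (x' ++ x)).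
- apply/eqP/fsum0 => j; rewrite -[RHS](residual_term e j mc); congr (_ + _).
  rewrite !gcoef_constM -mulrBr; congr (_ * _).
  rewrite !DeltaE !mulrDl !mul1r !gcoefD !gcoef_signM subrACA; congr (_ + _).
  by rewrite -mulrBr.
- by move=> j /sy ->; rewrite mulr0.
move=> j; rewrite mem_cat negb_or => /andP[/sgcoef -> // /sgcoef -> //].
by rewrite subrr.
Qed.
End Step.
End LoopEquations.

(** * The recursion *)

Section Recursion.
Variables (K : numClosedFieldType) (k l r : nat) (C : curve_data K k l r).
Local Notation R := (base_ring K k l).
Local Notation S := (gamma_ring K k l).
Variables (yg : 'I_r -> lser S) (psi : multidiff_family K k l r).
Implicit Types (w : multidiff_family K k l r).

Hypothesis HC : super_spectral_curve C.
Hypothesis Hsimple : simple_curve C.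
Hypothesis Hyg : rescaled C yg.

Lemma loop_candidate w : loop_solution C yg psi w -> candidate C w.
Proof. by case=> sw iw [lw _] _. Qed.

Lemma loop_recursion w : loop_solution C yg psi w -> recursion_formulae C yg psi w.
Proof.
move=> [sw iw ew hw] g n s gn sn; split; first by rewrite /Hop subrK.
  move=> d bd; rewrite (Hop_HPop HC (bounded_form_symmetric sw gn) sn).
  (* The term with B empty is the purely holomorphic part, prescribed by [psi]. *)
  rewrite (bigD1 finset.set0) ?finset.in_set0 //= gcoefD hw // /H0_rhs gcoefD.
  by congr (_ + gcoef d _); apply: eq_bigl => B; rewrite andbC.
exact: (Pop_loop HC Hsimple sw ew gn sn).
Qed.

Lemma agree_belowW w w' g n d d' : (d' <= d)%N ->
  agree_below w w' g n d -> agree_below w w' g n d'.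
Proof.
move=> dd ww g1 n1 d1 s gn1 lt; apply: ww => //.
by case: lt => [|[-> lt]]; [left|right; split => //; apply: leq_trans lt dd].
Qed.

Lemma candidate_recursive w : candidate C w -> recursive_at C yg psi w.
Proof.
move=> [sw iw lw] w' g n d [sw' iw' lw'] gn ww; split=> [s sn|PP s sn].
  apply: (gcoef_P0_rhs HC Hsimple Hyg sw sw' gn sn) => a e m s' d' dd sn' mc.
  by apply: (gcoef_Rec_agree HC Hsimple Hyg sw sw' lw lw' gn (agree_belowW dd ww)).
have bw := bounded_form_symmetric sw gn; have bw' := bounded_form_symmetric sw' gn.
(* P_0 fixes polar coefficients, so agreement of the principal parts is agreement of the polar parts
   in slot 0. *)
have polar0 : polar_agree d n.+1 0 (w g) (w' g).
  move=> t i0 tn neg; have t0 : (0 < size t)%N by rewrite tn.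
  by rewrite -(Pop_neg C (w' g) t0 neg) PP // (Pop_neg C (w g) t0 neg).
have [_ _ gw] := sw g n gn; have [_ _ gw'] := sw' g n gn.
have polar := graded_symmetric_polar gw gw' _ polar0.
rewrite /H0_rhs !gcoefD !gcoef_sum; congr (_ + _).
apply: eq_bigr => B /andP[/finset.set0Pn[q qB] _].
apply: (HPsteps_agree HC (q := q)) => //; first exact: enum_uniq.
  by rewrite mem_enum.
by apply: polar => // t; rewrite /regular_part opprB addrA subrK.
Qed.

Lemma recursion_unique w w' : candidate C w -> candidate C w' ->
  recursion_formulae C yg psi w -> recursion_formulae C yg psi w' ->
  forall g n s, (0 < 2 * g + n)%N -> size s = n.+1 -> w' g s = w g s.
Proof.
move=> cw cw' rw rw'.
suff H M d g n s : (2 * g + n = M)%N -> (0 < M)%N -> size s = n.+1 ->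
    gcoef d (w' g s) = gcoef d (w g s).
  by move=> g n s gn sn; apply: gcoefP => d; apply: H sn.
elim/ltn_ind: M d g n s => M IHM; elim/ltn_ind=> d IHd g n s gnM M0 sn.
have gn : (0 < 2 * g + n)%N by rewrite gnM.
(* The one coefficient exempt from the H_0 formula, degree 0 of omega_{0,2}, is B for both
   families. *)
have [bd|] := boolP (beyond_initial g n d); last first.
  rewrite /beyond_initial negbK => /eqP[g0 n1 d0].
  move: sn; rewrite g0 n1 d0; case: s => [|i [|j [|? ?]]] // _.
  by case: cw cw' => _ iw _ [_ iw' _]; rewrite iw iw'.
have ww : agree_below w w' g n d.
  move=> g' n' d' s' gn' [lt|[eqM lt]] sn'.
    by apply: (IHM (2 * g' + n')%N) sn'; rewrite // -gnM.
  by apply: (IHd d' lt g' n' s') => //; rewrite eqM.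
have [PP HH] := candidate_recursive cw cw' gn ww.
have [E _ _] := rw g n s gn sn; have [E' _ _] := rw' g n s gn sn.
have Peq t : size t = n.+1 ->
    gcoef d (Pop C 0 (w' g) t) = gcoef d (Pop C 0 (w g) t).
  move=> tn; have [_ _ ->] := rw g n t gn tn; have [_ _ ->] := rw' g n t gn tn.
  exact: PP.
have [_ H0 _] := rw g n s gn sn; have [_ H0' _] := rw' g n s gn sn.
by rewrite E E' [LHS]gcoefD [RHS]gcoefD Peq // H0 // H0' // HH.
Qed.
End Recursion.

Theorem theorem6p4 (R : realType) (k l r : nat)
    (C : curve_data R[i] k l r)
    (yg : 'I_r -> lser (gamma_ring R[i] k l))
    (psi omega : multidiff_family R[i] k l r)
    (HC : super_spectral_curve C)
    (Hsimple : simple_curve C)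
    (Hyg : rescaled C yg)
    (Hpsi : forall g n, (0 < 2 * g + n)%N -> holomorphic_form n.+1 (psi g))
    (Homega : loop_solution C yg psi omega) :
  [/\ recursion_formulae C yg psi omega,
      recursive_at C yg psi omega,
      forall omega', loop_solution C yg psi omega' ->
        forall g n s, (0 < 2 * g + n)%N -> size s = n.+1 -> omega' g s = omega g s &
      forall omega', candidate C omega' -> recursion_formulae C yg psi omega' ->
        forall g n s, (0 < 2 * g + n)%N -> size s = n.+1 -> omega' g s = omega g s].
Proof.
have cw := loop_candidate Homega.
have rw := loop_recursion HC Hsimple Homega.
have uniq omega' : candidate C omega' -> recursion_formulae C yg psi omega' ->
    forall g n s, (0 < 2 * g + n)%N -> size s = n.+1 -> omega' g s = omega g s.
  by move=> cw' rw'; apply: (recursion_unique HC Hsimple Hyg cw cw' rw rw').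
split=> //; first exact: candidate_recursive.
by move=> omega' Lw; apply: uniq; [apply: loop_candidate Lw|apply: loop_recursion Lw].
Qed.
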